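(* Let $\Gamma$ be a finite simplicial graph whose vertices $v$ are labelled by nontrivial cyclic groups $G_v$ (finite or infinite), let $G_\Gamma$ be the associated graph product, and suppose that $\Gamma$ contains no SIL. Let $\tilde\Gamma$ be the graph with vertices $p_{v,C}$ (one for each partial conjugation $\pi_{v,C}$ of $G_\Gamma$) and with the labelling by cyclic groups described in the context. Then the map $\phi: G_{\tilde\Gamma}\to Aut^{pc}(G_\Gamma)$, i.e. the homomorphism determined by $p_{v,C}\mapsto \pi_{v,C}$, is an isomorphism. In particular, $Aut^{pc}(G_\Gamma)$ is a graph product of cyclic groups of the same order(s) as the vertex groups of $G_\Gamma$ (the vertex group at $p_{v,C}$ being cyclic of order $|v|$).
   Context: Graph product: for a finite simplicial graph $\Gamma$ with vertex set $V$ and groups $G_v$ ($v\in V$), $G_\Gamma$ is the quotient of the free product of the $G_v$ by the relations that $G_v$ and $G_w$ commute elementwise whenever $v,w$ are joined by an edge. When the $G_v$ are cyclic, $v$ also denotes a fixed generator of $G_v$, so $V$ generates $G_\Gamma$, and $|v|$ denotes the order of $G_v$ (possibly $\infty$). $lk(v)$ is the full subgraph spanned by the vertices adjacent to $v$; $st(v)$ is the full subgraph spanned by $v$ and $lk(v)$. For a subgraph $A$, $\Gamma\smallsetminus A$ is the full subgraph spanned by the vertices not in $A$. $d(v,w)=d_\Gamma(v,w)$ is the edge-path distance, equal to $\infty$ (so $\ge 2$) for vertices in different components. SIL: $\Gamma$ has a separating intersection of links (SIL) if for some pair of vertices $v,w$ with $d_\Gamma(v,w)\ge 2$ there is a connected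 component of $\Gamma\smallsetminus(lk(v)\cap lk(w))$ containing neither $v$ nor $w$. Partial conjugation: for a vertex $v$ and a connected component $C$ of $\Gamma\smallsetminus st(v)$, $\pi_{v,C}\in Aut(G_\Gamma)$ is the automorphism sending each generator $x\in C$ to $vxv^{-1}$ and fixing every generator not in $C$. $Aut^{pc}(G_\Gamma)$ is the subgroup of $Aut(G_\Gamma)$ generated by all partial conjugations. The graph $\tilde\Gamma$: its vertices are symbols $p_{v,C}$, one for each pair $(v,C)$ with $v\in V$ and $C$ a connected component of $\Gamma\smallsetminus st(v)$. Two distinct vertices $p_{v,C}$ and $p_{w,D}$ are joined by an edge unless $d(v,w)\ge 2$, $v\in D$ and $w\in C$. The vertex $p_{v,C}$ is labelled by a cyclic group of order $|v|$ with generator also written $p_{v,C}$. $G_{\tilde\Gamma}$ is the resulting graph product. *)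

(* Defs.v *)
From HB Require Import structures.
From mathcomp Require Import all_boot.
From mathcomp Require Import boolp classical_sets cardinality.

Set Implicit Arguments.
Unset Strict Implicit.
Unset Printing Implicit Defensive.

Local Open Scope quotient_scope.
Local Open Scope group_scope.

Record sgraph := SGraph {
  vertex :> finType;
  adj : rel vertex;
  adj_sym : symmetric adj;
  adj_irr : irreflexive adj }.

Section Graphs.
Variable Gamma : sgraph.
Implicit Types (v w : Gamma) (A C : {set Gamma}).

Definition lk v : {set Gamma} := [set w | adj v w].
Definition st v : {set Gamma} := v |: lk v.

Definition is_walk_length v w (n : nat) : bool :=
  `[< exists p, [/\ path (@adj Gamma) v p, last v p = w & size p = n] >].

(* Edge-path distance; [None] stands for infinity. *)
Definition dist v w : option nat :=
  if pselect (exists n, is_walk_length v w n) is left ex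
  then Some (ex_minn ex) else None.

Definition dist_ge2 v w : bool :=
  if dist v w is Some d then (2 <= d)%N else true.

Definition induced_adj A : rel Gamma :=
  [rel v w | [&& v \in A, w \in A & adj v w]].

(* The vertex sets of the connected components of the full subgraph spanned
   by A. *)
Definition components A : {set {set Gamma}} :=
  equivalence_partition (connect (induced_adj A)) A.

Definition has_SIL : Prop :=
  exists v w, dist_ge2 v w /\
  exists2 C, C \in components (~: (lk v :&: lk w)) & v \notin C /\ w \notin C.

Lemma is_walk_length_sym v w n : is_walk_length v w n = is_walk_length w v n.
Proof.
suff imp v1 w1 : is_walk_length v1 w1 n -> is_walk_length w1 v1 n.
  by apply/idP/idP; apply: imp.
move=> /asboolP[p [pp lp sp]]; apply/asboolP.
exists (rev (belast v1 p)); split; last by rewrite size_rev size_belast.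
- by rewrite -lp rev_path; apply: sub_path pp => x y /=; rewrite adj_sym.
- by case: p lp {pp sp} => [//|x p] _; rewrite /= rev_cons last_rcons.
Qed.

Lemma dist_sym v w : dist v w = dist w v.
Proof.
rewrite /dist; case: pselect => [ex1|nex1]; case: pselect => [ex2|nex2] //.
- congr Some; apply: eq_ex_minn => n; exact: is_walk_length_sym.
- by case: nex2; case: ex1 => n; rewrite is_walk_length_sym; exists n.
- by case: nex1; case: ex2 => n; rewrite is_walk_length_sym; exists n.
Qed.

Lemma induced_connect_equiv A :
  {in A & &, equivalence_rel (connect (induced_adj A))}.
Proof.
have sym : connect_sym (induced_adj A).
  by apply: sym_connect_sym => x y; rewrite /induced_adj /= adj_sym andbCA.
by move=> x y z _ _ _; split=> [|xy]; [exact: connect0|exact: same_connect].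
Qed.

Lemma components_sub A C : C \in components A -> C \subset A.
Proof.
have /and3P[/eqP covA _ _] := equivalence_partitionP (@induced_connect_equiv A).
by move=> CA; rewrite -covA; apply: (finset.bigcup_sup C).
Qed.

Lemma components_adj A C x y :
  C \in components A -> x \in C -> y \in A -> adj x y -> y \in C.
Proof.
move=> /imsetP[z zA ->]; rewrite !inE => /andP[xA zx] yA xy.
by rewrite yA (connect_trans zx) // connect1 // /induced_adj /= xA yA.
Qed.

End Graphs.

Section GraphProduct.
Variables (Gamma : sgraph) (G : Gamma -> groupType).

Definition letter : Type := {v : Gamma & G v}.
HB.instance Definition _ := Choice.on letter.

Definition lett (v : Gamma) (a : G v) : letter := Tagged (fun v => G v) a.

(* [GPone] and [GPmul] are the relations of the free product of the [G v];
   [GPcomm] are the additional relations of the graph product. *)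
Inductive gp_rule : seq letter -> seq letter -> Prop :=
| GPone v : gp_rule [:: lett (1 : G v)] [::]
| GPmul v (a b : G v) : gp_rule [:: lett a; lett b] [:: lett (a * b)]
| GPcomm v w (a : G v) (b : G w) :
    adj v w -> gp_rule [:: lett a; lett b] [:: lett b; lett a].

Inductive gp_equiv : seq letter -> seq letter -> Prop :=
| GPstep s t l r : gp_rule l r -> gp_equiv (s ++ l ++ t) (s ++ r ++ t)
| GPrefl s : gp_equiv s s
| GPsym s t : gp_equiv s t -> gp_equiv t s
| GPtrans s t u : gp_equiv s t -> gp_equiv t u -> gp_equiv s u.

Definition gp_eqb : rel (seq letter) := fun s t => `[< gp_equiv s t >].

Lemma gp_eqb_refl : reflexive gp_eqb.
Proof. by move=> s; apply/asboolP; exact: GPrefl. Qed.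
Lemma gp_eqb_sym : symmetric gp_eqb.
Proof. by move=> s t; apply/asboolP/asboolP; exact: GPsym. Qed.
Lemma gp_eqb_trans : transitive gp_eqb.
Proof.
by move=> t s u /asboolP st /asboolP tu; apply/asboolP; exact: GPtrans tu.
Qed.

Canonical gp_eqb_equiv :=
  EquivRel gp_eqb gp_eqb_refl gp_eqb_sym gp_eqb_trans.

Definition graph_product : Type := {eq_quot gp_eqb}.
HB.instance Definition _ := Choice.on graph_product.
HB.instance Definition _ := EqQuotient.on graph_product.

Definition gp_class (s : seq letter) : graph_product := \pi_graph_product s.

Lemma gp_classP s t : gp_class s = gp_class t <-> gp_equiv s t.
Proof.
split=> [/eqmodP/asboolP//|st]; apply/eqmodP; exact/asboolP.
Qed.

Lemma gp_classK (x : graph_product) : gp_class (repr x) = x.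
Proof. exact: reprK. Qed.

Lemma gp_equiv_cat s s' t t' :
  gp_equiv s s' -> gp_equiv t t' -> gp_equiv (s ++ t) (s' ++ t').
Proof.
move=> ss tt; apply: (@GPtrans _ (s' ++ t)).
- elim: ss => {s s' tt} [s u l r lr|s|s u _|s u v _ su _ uv].
  + by rewrite -!catA; exact: GPstep.
  + exact: GPrefl.
  + exact: GPsym.
  + exact: GPtrans uv.
- elim: tt => {t t' ss} [t u l r lr|t|t u _|t u v _ su _ uv].
  + by rewrite !(catA s'); exact: GPstep.
  + exact: GPrefl.
  + exact: GPsym.
  + exact: GPtrans uv.
Qed.

Definition inv_word (s : seq letter) : seq letter :=
  rev [seq lett (tagged x)^-1 | x : letter <- s].

Definition gp_mul (x y : graph_product) := gp_class (repr x ++ repr y).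
Definition gp_one := gp_class [::].
Definition gp_inv (x : graph_product) := gp_class (inv_word (repr x)).

Lemma gp_mul_class s t : gp_mul (gp_class s) (gp_class t) = gp_class (s ++ t).
Proof.
by apply/gp_classP/gp_equiv_cat; apply/gp_classP; rewrite gp_classK.
Qed.

Lemma gp_mulA : associative gp_mul.
Proof.
move=> x y z; rewrite -(gp_classK x) -(gp_classK y) -(gp_classK z).
by rewrite !gp_mul_class catA.
Qed.
Lemma gp_mul1 : left_id gp_one gp_mul.
Proof. by move=> x; rewrite -(gp_classK x) gp_mul_class. Qed.
Lemma gp_mulr1 : right_id gp_one gp_mul.
Proof. by move=> x; rewrite -(gp_classK x) gp_mul_class cats0. Qed.

Lemma gp_equiv_pair v (a b : G v) s t :
  a * b = 1 -> gp_equiv (s ++ [:: lett a; lett b] ++ t) (s ++ t).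
Proof.
move=> ab; apply: GPtrans (GPstep s t (GPmul a b)) _; rewrite ab.
exact: (GPstep s t (GPone v)).
Qed.

Lemma gp_mulV : left_inverse gp_one gp_inv gp_mul.
Proof.
move=> x; rewrite -{2}(gp_classK x) gp_mul_class; apply/gp_classP.
elim: (repr x) => [|[v a] s IHs]; first exact: GPrefl.
rewrite /inv_word /= rev_cons cat_rcons.
apply: GPtrans IHs; exact: gp_equiv_pair (mulVg a).
Qed.
Lemma gp_mulrV : right_inverse gp_one gp_inv gp_mul.
Proof.
move=> x; rewrite -{1}(gp_classK x) gp_mul_class; apply/gp_classP.
elim/last_ind: (repr x) => [|s [v a] IHs]; first exact: GPrefl.
rewrite /inv_word /= map_rcons rev_rcons cat_rcons.
apply: GPtrans IHs; exact: gp_equiv_pair (mulgV a).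
Qed.

HB.instance Definition _ := isGroup.Build graph_product
  gp_mulA gp_mul1 gp_mulr1 gp_mulV gp_mulrV.

Lemma gp_classM s t : gp_class (s ++ t) = gp_class s * gp_class t.
Proof. exact/esym/gp_mul_class. Qed.

Definition gp_inj (v : Gamma) (a : G v) : graph_product :=
  gp_class [:: lett a].

Lemma gp_injM v : {morph @gp_inj v : a b / a * b}.
Proof.
move=> a b; rewrite -gp_classM; apply/esym/gp_classP.
exact: (GPstep [::] [::] (GPmul a b)).
Qed.

HB.instance Definition _ v :=
  isMultiplicative.Build (G v) graph_product (@gp_inj v) (@gp_injM v).

Lemma gp_inj1 v : gp_inj (1 : G v) = 1.
Proof. by apply/gp_classP; exact: (GPstep [::] [::] (GPone v)). Qed.

Lemma gp_inj_comm v w (a : G v) (b : G w) :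
  adj v w -> commute (gp_inj a) (gp_inj b).
Proof.
move=> vw; rewrite /commute -!gp_classM; apply/gp_classP.
exact: (GPstep [::] [::] (GPcomm a b vw)).
Qed.

Lemma gp_class_cons v (a : G v) s :
  gp_class (lett a :: s) = gp_inj a * gp_class s.
Proof. by rewrite -gp_classM. Qed.

(* The universal property: a family of homomorphisms on the vertex groups
   whose images commute along edges extends uniquely to the graph product.
   [gp_lift f] is that extension (it is meaningful only for such families). *)
Definition eval_word (K : groupType) (f : forall v, G v -> K)
    (s : seq letter) : K :=
  foldr (fun x k => f (tag x) (tagged x) * k) 1 s.

Definition gp_lift (K : groupType) (f : forall v, G v -> K)
    (x : graph_product) : K :=
  eval_word f (repr x).

Lemma eval_word_cat (K : groupType) (f : forall v, G v -> K) s t :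
  eval_word f (s ++ t) = eval_word f s * eval_word f t.
Proof. by elim: s => [|x s IHs] /=; rewrite ?mul1g // IHs mulgA. Qed.

Section Lift.
Variables (K : groupType) (f : forall v, G v -> K).
Hypothesis fM : forall v, {morph @f v : a b / a * b}.
Hypothesis fC :
  forall v w (a : G v) (b : G w), adj v w -> commute (f a) (f b).

Lemma gp_lift_class s : gp_lift f (gp_class s) = eval_word f s.
Proof.
have f1 v : f (1 : G v) = 1.
  by apply: (mulgI (f (1 : G v))); rewrite -fM !mulg1.
have : gp_equiv (repr (gp_class s)) s by apply/gp_classP; rewrite gp_classK.
rewrite /gp_lift; move: (repr _) => t.
elim=> {s t} [s t l r lr|//|s t _ ->//|s t u _ -> //].
rewrite !eval_word_cat; congr (_ * (_ * _)).
case: lr => [v|v a b|v w a b vw] /=.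
- by rewrite f1 mulg1.
- by rewrite !mulg1 fM.
- by rewrite !mulg1 fC.
Qed.

Lemma gp_lift_inj v (a : G v) : gp_lift f (gp_inj a) = f a.
Proof. by rewrite gp_lift_class /= mulg1. Qed.

Lemma gp_liftM : {morph gp_lift f : x y / x * y}.
Proof.
move=> x y; rewrite -(gp_classK x) -(gp_classK y) -gp_classM.
by rewrite !gp_lift_class eval_word_cat.
Qed.
End Lift.

Lemma gp_hom_ext (K : groupType) (f1 f2 : graph_product -> K) :
    {morph f1 : x y / x * y} -> {morph f2 : x y / x * y} ->
    (forall v (a : G v), f1 (gp_inj a) = f2 (gp_inj a)) ->
  f1 =1 f2.
Proof.
move=> M1 M2 f12 x.
have unit (f : graph_product -> K) : {morph f : x y / x * y} -> f 1 = 1.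
  by move=> fM; apply: (mulgI (f 1)); rewrite -fM !mulg1.
rewrite -(gp_classK x); elim: (repr x) => [|[v a] s IHs].
  by rewrite -[gp_class _]/(1 : graph_product) !unit.
by rewrite gp_class_cons M1 M2 f12 IHs.
Qed.

End GraphProduct.

Section Automorphisms.
Variable G : groupType.

Definition is_aut (f : G -> G) : Prop :=
  {morph f : x y / x * y} /\ bijective f.

Definition Aut : Type := {f : G -> G | `[< is_aut f >]}.
HB.instance Definition _ := SubChoice.on Aut.

Implicit Types f g : Aut.

Definition mk_aut (f : G -> G) (fP : is_aut f) : Aut := Sub f (asboolT fP).

Lemma autP f : is_aut (val f).
Proof. exact/asboolP/(valP f). Qed.

Lemma aut_mul_subproof f g : is_aut (val f \o val g).
Proof.
have [[fM fb] [gM gb]] := (autP f, autP g); split; last exact: bij_comp.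
by move=> x y /=; rewrite gM fM.
Qed.

Lemma aut_one_subproof : is_aut idfun.
Proof. by split; [|exists idfun]. Qed.

Lemma aut_inv_subproof f :
  exists h, [/\ is_aut h, cancel (val f) h & cancel h (val f)].
Proof.
have [fM [h fK hK]] := autP f; exists h; split=> //; split; last by exists (val f).
by move=> x y; rewrite -{1}(hK x) -{1}(hK y) -fM fK.
Qed.

Definition aut_mul f g : Aut := mk_aut (aut_mul_subproof f g).
Definition aut_one : Aut := mk_aut aut_one_subproof.
Definition aut_inv f : Aut :=
  let: exist _ hP := cid (aut_inv_subproof f) in
  let: And3 h_aut _ _ := hP in mk_aut h_aut.

Lemma aut_mulA : associative aut_mul.
Proof. by move=> f g h; apply: val_inj. Qed.
Lemma aut_mul1 : left_id aut_one aut_mul.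
Proof. by move=> f; apply: val_inj. Qed.
Lemma aut_mulr1 : right_id aut_one aut_mul.
Proof. by move=> f; apply: val_inj. Qed.
Lemma aut_mulV : left_inverse aut_one aut_inv aut_mul.
Proof.
move=> f; apply: val_inj; rewrite /aut_inv.
by case: cid => h [h_aut fK hK] /=; apply/funext => x /=; rewrite fK.
Qed.
Lemma aut_mulrV : right_inverse aut_one aut_inv aut_mul.
Proof.
move=> f; apply: val_inj; rewrite /aut_inv.
by case: cid => h [h_aut fK hK] /=; apply/funext => x /=; rewrite hK.
Qed.

HB.instance Definition _ := isGroup.Build Aut
  aut_mulA aut_mul1 aut_mulr1 aut_mulV aut_mulrV.

End Automorphisms.

Section Generated.
Variables (G : groupType) (S : set G).

Definition generated_set : set G :=
  smallest [set H : set G | group_closed (mem H)]%classic S.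

Definition generated : Type := {x : G | x \in generated_set}.
HB.instance Definition _ := SubChoice.on generated.

Lemma generated_closed : group_closed (mem generated_set).
Proof.
have memP x : (x \in mem generated_set) = (x \in generated_set) by [].
split=> [|x y]; rewrite !memP; first by apply/mem_set=> H [[/set_mem]].
move=> /set_mem xS /set_mem yS; apply/mem_set=> H HH.
have [[_ HF] _] := HH; apply/set_mem/HF; apply/mem_set; first exact: xS.
exact: yS.
Qed.

HB.instance Definition _ :=
  SubChoice_isSubGroup.Build G (mem generated_set) generated generated_closed.

End Generated.

Definition isomorphic (G H : groupType) : Prop :=
  exists f : {multiplicative G -> H}, bijective f.

Definition is_generator (G : groupType) (x : G) : Prop :=
  forall y, exists n, y = x ^+ n \/ y = x ^- n.

Definition is_cyclic (G : groupType) : Prop := exists x : G, is_generator x.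

(* Equality of orders, finite or infinite (a cyclic group is countable). *)
Definition same_order (G H : groupType) : Prop := ([set: G] #= [set: H])%card.

(* The pairs (v, C) with C a connected component of Gamma \ st(v); such a
   pair is the vertex p_{v,C} of [pc_graph] below. *)
Definition pc_index (Gamma : sgraph) : Type :=
  {p : Gamma * {set Gamma} | p.2 \in components (~: st p.1)}.
HB.instance Definition _ (Gamma : sgraph) := SubFinite.on (pc_index Gamma).

Definition pc_vertex (Gamma : sgraph) (p : pc_index Gamma) : Gamma :=
  (val p).1.
Definition pc_comp (Gamma : sgraph) (p : pc_index Gamma) : {set Gamma} :=
  (val p).2.

Section PartialConjugation.
Variables (Gamma : sgraph) (G : Gamma -> groupType).
Implicit Types p : pc_index Gamma.

Definition pconj_gens p (a : G (pc_vertex p)) (x : Gamma) (b : G x) :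
    graph_product G :=
  if x \in pc_comp p then gp_inj a * gp_inj b * (gp_inj a)^-1 else gp_inj b.

Definition pconj_fun p (a : G (pc_vertex p)) :
    graph_product G -> graph_product G :=
  gp_lift (pconj_gens a).

Lemma pc_comp_st p x : x \in pc_comp p -> x \notin st (pc_vertex p).
Proof.
by move=> xC; have /fintype.subsetP/(_ x xC) := components_sub (valP p); rewrite inE.
Qed.

Lemma pconj_gensM p (a : G (pc_vertex p)) x :
  {morph @pconj_gens p a x : b c / b * c}.
Proof.
move=> b c; rewrite /pconj_gens gp_injM; case: ifP => // _.
by rewrite !mulgA mulgVK.
Qed.

Lemma pconj_gensC p (a : G (pc_vertex p)) x y (b : G x) (c : G y) :
  adj x y -> commute (pconj_gens a b) (pconj_gens a c).
Proof.
have half x1 y1 (b1 : G x1) (c1 : G y1) : adj x1 y1 -> x1 \in pc_comp p ->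
    y1 \notin pc_comp p ->
    commute (gp_inj a * gp_inj b1 * (gp_inj a)^-1) (gp_inj c1).
  move=> xy xC yC; have xst := pc_comp_st xC.
  have yst : y1 \in st (pc_vertex p).
    apply: contraNT yC => yst; apply: (components_adj (valP p) xC) => //.
    by rewrite inE.
  have cay : commute (gp_inj c1) (gp_inj a).
    apply: commute_sym; apply: gp_inj_comm; move: yst; rewrite !inE.
    case/orP=> // /eqP yv; move: xst; rewrite !inE -yv adj_sym xy.
    by rewrite orbT.
  apply: commute_sym; apply: commuteM; last exact: commuteV.
  by apply: commuteM => //; apply: commute_sym; exact: gp_inj_comm.
move=> xy; rewrite /pconj_gens.
case: ifPn => xC; case: ifPn => yC.
- by rewrite /commute !mulgA !mulgVK -!(mulgA (gp_inj a)) (gp_inj_comm b c xy).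
- exact: half.
- by apply: commute_sym; apply: half; rewrite // adj_sym.
- exact: gp_inj_comm.
Qed.

Lemma pconj_fun_inj p (a : G (pc_vertex p)) x (b : G x) :
  pconj_fun a (gp_inj b) = pconj_gens a b.
Proof. by apply: gp_lift_inj; [exact: pconj_gensM|exact: pconj_gensC]. Qed.

Lemma pconj_funM p (a : G (pc_vertex p)) :
  {morph pconj_fun a : x y / x * y}.
Proof. by apply: gp_liftM; [exact: pconj_gensM|exact: pconj_gensC]. Qed.

Lemma pconj_funK p (a a' : G (pc_vertex p)) :
  a * a' = 1 -> cancel (pconj_fun a') (pconj_fun a).
Proof.
move=> aa'.
have fix_v (c : G (pc_vertex p)) : pconj_fun a (gp_inj c) = gp_inj c.
  rewrite pconj_fun_inj /pconj_gens; case: ifPn => // /pc_comp_st.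
  by rewrite !inE eqxx.
have fV : {morph pconj_fun a : x / x^-1}.
  move=> x; apply: (mulgI (pconj_fun a x)); rewrite -pconj_funM !mulgV.
  by apply: (mulgI (pconj_fun a 1)); rewrite -pconj_funM !mulg1.
have a1 : gp_inj a' * gp_inj a = 1.
  by rewrite -gp_injM; apply/eqP; rewrite -(gp_inj1 G (pc_vertex p)) -(mulVg a);
     rewrite -[a'](mulKg a) aa' mulg1.
apply: (@gp_hom_ext _ _ _ (pconj_fun a \o pconj_fun a') id).
- by move=> x y /=; rewrite !pconj_funM.
- by [].
move=> x b /=; rewrite pconj_fun_inj /pconj_gens; case: ifPn => xC; last first.
  by rewrite pconj_fun_inj /pconj_gens (negPf xC).
rewrite !pconj_funM fV !fix_v pconj_fun_inj /pconj_gens xC.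
by rewrite -!mulgA -invgM a1 invg1 mulg1 !mulgA a1 mul1g.
Qed.

Variable g : forall v, G v.

Lemma pconj_is_aut p : is_aut (pconj_fun (g (pc_vertex p))).
Proof.
split; first exact: pconj_funM.
exists (pconj_fun (g (pc_vertex p))^-1); apply: pconj_funK.
- exact: mulVg.
- exact: mulgV.
Qed.

(* The partial conjugation x |-> v x v^-1 (x in C), where the generator of the
   vertex group at v is [g v]. *)
Definition pconj p : Aut (graph_product G) := mk_aut (pconj_is_aut p).

Lemma pconj_gen p x :
  val (pconj p) (gp_inj (g x)) =
  if x \in pc_comp p
  then gp_inj (g (pc_vertex p)) * gp_inj (g x) * (gp_inj (g (pc_vertex p)))^-1
  else gp_inj (g x).
Proof. exact: pconj_fun_inj. Qed.

Definition Autpc : Type := generated (range pconj).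
HB.instance Definition _ := SubGroup.on Autpc.

Lemma pconj_generated p : pconj p \in generated_set (range pconj).
Proof. by apply/mem_set=> H [_]; apply; exists p. Qed.

Definition pi_pc p : Autpc := Sub (pconj p) (pconj_generated p).

End PartialConjugation.

Section PcGraph.
Variable Gamma : sgraph.
Implicit Types p q : pc_index Gamma.

Definition pc_adj : rel (pc_index Gamma) := fun p q =>
  (p != q) && ~~ [&& dist_ge2 (pc_vertex p) (pc_vertex q),
                     pc_vertex p \in pc_comp q & pc_vertex q \in pc_comp p].

Lemma pc_adj_sym : symmetric pc_adj.
Proof.
by move=> p q; rewrite /pc_adj eq_sym /dist_ge2 dist_sym [(_ \in _) && _]andbC.
Qed.

Lemma pc_adj_irr : irreflexive pc_adj.
Proof. by move=> p; rewrite /pc_adj eqxx. Qed.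

Definition pc_graph : sgraph := SGraph pc_adj_sym pc_adj_irr.

End PcGraph.

(* Main.v *)
(* Let K be the graph product over the pc graph whose group at p = p_{v,C} is
   G_v.  Without a SIL, if d(v,w) >= 2 and v is not in D, then the component D
   of Gamma - st(w) either lies in C or misses C, according to whether w is in
   C; hence pi_{v,C} and pi_{w,D} commute along the edges of the pc graph, and
   there is a homomorphism phi : K -> Aut^pc(G_Gamma).

   For injectivity, sending b in G_v to the product over C of its copies at the
   p_{v,C} is a homomorphism iota : G_Gamma -> K, and it is equivariant:
   iota (phi(y)(z)) = y (iota z) y^-1.  So the kernel of phi centralizes the
   image of iota.  If y <> 1 centralizes it, write y as a reduced word starting
   with a letter at p = p_{w,D}, choose v in D and b <> 1 in G_v, and let
   q = p_{v,C} with w in C; then p and q are not adjacent.  In (iota b) y the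
   letter b at q comes before every letter at p, and the other letters of
   iota b commute with p, so q is initial in the reduced form and p is not;
   but in y (iota b), where iota b has no letter at p, the letter at p stays
   initial.  This contradicts the uniqueness of reduced words up to
   commutation, so y = 1. *)
From HB Require Import structures.
Require Import Defs.
From mathcomp Require Import all_boot.
From mathcomp Require Import boolp classical_sets cardinality.

Set Implicit Arguments.
Unset Strict Implicit.
Unset Printing Implicit Defensive.

Local Open Scope group_scope.

(** * Homomorphisms and cyclic groups *)

Section GroupMorphism.
Variables (G H : groupType) (f : G -> H).
Hypothesis fM : {morph f : x y / x * y}.

Lemma morph1g : f 1 = 1.
Proof. by apply: (mulgI (f 1)); rewrite -fM !mulg1. Qed.

Lemma morphVg : {morph f : x / x^-1}.
Proof. by move=> x; apply: (mulgI (f x)); rewrite -fM !mulgV morph1g. Qed.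

Lemma morphXg n : {morph f : x / x ^+ n}.
Proof. by move=> x; elim: n => [|n IHn]; rewrite ?morph1g // !expgS fM IHn. Qed.

Lemma morph_injg : (forall x, f x = 1 -> x = 1) -> injective f.
Proof.
by move=> f1 x y e; apply/divg1_eq/f1; rewrite fM morphVg e mulgV.
Qed.

End GroupMorphism.

Section Cyclic.
Variables (G : groupType) (x : G).
Hypothesis x_gen : is_generator x.

Lemma generator_commute (a b : G) : commute a b.
Proof.
have cx c d : commute c x -> commute c d.
  move=> cx; have [n [->|->]] := x_gen d; first exact: commuteX.
  exact/commuteV/commuteX.
exact/cx/commute_sym/cx/commute_refl.
Qed.

Lemma generator_ext (H : groupType) (f1 f2 : G -> H) :
    {morph f1 : a b / a * b} -> {morph f2 : a b / a * b} ->
  f1 x = f2 x -> f1 =1 f2.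
Proof.
move=> M1 M2 e a; have [n [->|->]] := x_gen a.
  by rewrite (morphXg M1) (morphXg M2) e.
by rewrite (morphVg M1) (morphVg M2) (morphXg M1) (morphXg M2) e.
Qed.

(** Every element has the form [x ^+ i * x ^- j]. The map uses a chosen pair of exponents, and the
    hypothesis on [y] makes its value independent of the choice. *)
Lemma generator_lift (H : groupType) (y : H) :
    (forall n, x ^+ n = 1 -> y ^+ n = 1) ->
  exists2 f : G -> H, {morph f : a b / a * b} & f x = y.
Proof.
move=> xy.
have xy_eq i j : x ^+ i = x ^+ j -> y ^+ i = y ^+ j.
  wlog ij : i j / (i <= j)%N => [hw e|].
    by case/orP: (leq_total i j) => ij; [|apply/esym]; apply: hw.
  rewrite -(subnK ij) !expgnDr => e; rewrite (xy (j - i)%N) ?mul1g //.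
  by apply: (mulIg (x ^+ i)); rewrite -e mul1g.
have ex a : exists ij : nat * nat, a = x ^+ ij.1 * x ^- ij.2.
  have [n [->|->]] := x_gen a; first by exists (n, 0%N); rewrite /= invg1 mulg1.
  by exists (0%N, n); rewrite /= mul1g.
pose f a := let ij := sval (cid (ex a)) in y ^+ ij.1 * y ^- ij.2.
have yC (i j : nat) : commute (y ^+ i) (y ^- j).
  by apply: commuteV; apply: commuteX2.
have fE i j : f (x ^+ i * x ^- j) = y ^+ i * y ^- j.
  rewrite /f; case: cid => -[k l] /= e.
  (* Clearing the inverse powers in x^i x^-j = x^k x^-l leaves an identity between positive powers,
     which transfers to [y]. *)
  suff e' : y ^+ (k + j) = y ^+ (i + l).
    apply: (mulIg (y ^+ j)); rewrite mulgVK -mulgA -(yC j l) mulgA -expgnDr e'.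
    by rewrite expgnDr mulgK.
  apply/esym/xy_eq; rewrite !expgnDr; apply: (mulIg (x ^- j)); rewrite mulgK.
  by rewrite -mulgA (generator_commute (x ^+ l)) mulgA e mulgVK.
exists f => [a b|]; last first.
  by rewrite -[x]expg1 -[x ^+ 1]mulg1 -invg1 (fE 1%N 0%N) /= invg1 mulg1.
have [[i j] /= ->] := ex a; have [[k l] /= ->] := ex b.
have DD (H1 : groupType) (z : H1)
    (c : forall i j : nat, commute (z ^+ i) (z ^- j)) :
    z ^+ i * z ^- j * (z ^+ k * z ^- l) = z ^+ (i + k) * z ^- (l + j).
  by rewrite !expgnDr invgM -!mulgA; congr (_ * _); rewrite !mulgA -c.
rewrite !fE DD ?fE ?DD // => *; exact: generator_commute.
Qed.

Lemma generator_card n : (0 < n)%N -> x ^+ n = 1 ->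
  ([set: G]%classic #<= `I_n)%card.
Proof.
move=> n0 xn.
have -> : [set: G]%classic = ((fun i => x ^+ i) @` `I_n)%classic.
  2: exact: card_image_le.
apply/seteqP; split=> // a _.
have xmod k : x ^+ k = x ^+ (k %% n).
  by rewrite {1}(divn_eq k n) expgnDr mulnC expgnA xn expg1n mul1g.
suff [k ->] : exists k, a = x ^+ k by exists (k %% n)%N; rewrite -?xmod //= ltn_mod.
have [k [->|->]] := x_gen a; first by exists k.
(* Since x^(nk) = 1, this exponent gives the inverse of x^k; 0 < n keeps the truncated subtraction
   exact. *)
exists (n * k - k)%N; apply: (mulIg (x ^+ k)).
by rewrite -expgnDr subnK ?leq_pmull // mulVg expgnA xn expg1n.
Qed.

End Cyclic.

(** Pigeonhole: the n + 1 powers x^0, ..., x^n cannot all differ, and the quotient of two equal ones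
    gives m. *)
Lemma card_le_power (G : groupType) (x : G) n : ([set: G]%classic #<= `I_n)%card ->
  exists m, [/\ (0 < m)%N, (m <= n)%N & x ^+ m = 1].
Proof.
move=> Gn; apply: contrapT => nm.
suff : (`I_n.+1 #<= `I_n)%card by rewrite card_le_II ltnn.
apply: card_le_trans Gn.
have injx : {in `I_n.+1%classic &, injective (fun i => x ^+ i)}.
  suff H i j : (i <= j)%N -> (j <= n)%N -> x ^+ i = x ^+ j -> i = j.
    move=> i j; rewrite !inE /= !ltnS => iI jI e.
    by case/orP: (leq_total i j) => ij; [|apply/esym]; apply: H.
  move=> ij jn e; apply/eqP; rewrite eqn_leq ij leqNgt; apply/negP => ltij.
  apply: nm; exists (j - i)%N; split; first by rewrite subn_gt0.
    exact: leq_trans (leq_subr _ _) jn.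
  by rewrite expgnFr // -e mulgV.
by rewrite -(card_le_eql (inj_card_eq injx)); apply: subset_card_le.
Qed.

(** If [x] has finite order m, then [H] has at most m elements, so y^k = 1 for some 0 < k <= m. The
    symmetric count and the minimality of m force k = m, and m divides n. *)
Lemma same_order_power (G H : groupType) (x : G) (y : H) n :
    is_generator x -> is_generator y -> same_order G H ->
  x ^+ n = 1 -> y ^+ n = 1.
Proof.
move=> xg yg GH; case: n => // n xn.
have ex : exists m, (0 < m)%N && (x ^+ m == 1) by exists n.+1; rewrite xn eqxx.
case: (ex_minnP ex) => m /andP[m0 /eqP xm] mmin.
have [k [k0 km yk]] : exists k, [/\ (0 < k)%N, (k <= m)%N & y ^+ k = 1].
  by apply: card_le_power; rewrite -(card_le_eql GH); exact: generator_card.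
have [l [l0 lk xl]] : exists l, [/\ (0 < l)%N, (l <= k)%N & x ^+ l = 1].
  by apply: card_le_power; rewrite (card_le_eql GH); exact: generator_card.
have ml : (m <= l)%N by apply: mmin; rewrite l0 xl eqxx.
have ekm : k = m by apply/eqP; rewrite eqn_leq km (leq_trans ml).
have xr : x ^+ (n.+1 %% m) = 1.
  move: xn; rewrite {1}(divn_eq n.+1 m) expgnDr mulnC expgnA xm expg1n.
  by rewrite mul1g.
have r0 : (n.+1 %% m = 0)%N.
  apply/eqP; rewrite -leqn0 leqNgt; apply/negP => r0.
  by have := mmin (n.+1 %% m)%N; rewrite r0 xr eqxx leqNgt ltn_mod m0 => /(_ isT).
by rewrite (divn_eq n.+1 m) r0 addn0 mulnC expgnA -ekm yk expg1n.
Qed.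

Lemma same_order_iso (G H : groupType) (x : G) (y : H) :
    is_generator x -> is_generator y -> same_order G H ->
  exists f : (G -> H) * (H -> G),
    [/\ {morph f.1 : a b / a * b}, {morph f.2 : a b / a * b},
        f.1 x = y, cancel f.1 f.2 & cancel f.2 f.1].
Proof.
move=> xg yg GH.
have HG : same_order H G by rewrite /same_order card_eq_sym.
have [f fM fx] := generator_lift xg (fun n => same_order_power xg yg GH (n := n)).
have [f' f'M fy] := generator_lift yg (fun n => same_order_power yg xg HG (n := n)).
exists (f, f'); split=> //=.
  apply: (generator_ext xg (f1 := f' \o f) (f2 := id)) => //= [a b|].
    by rewrite /= fM f'M.
  by rewrite /= fx fy.
apply: (generator_ext yg (f1 := f \o f') (f2 := id)) => //= [a b|].
  by rewrite /= f'M fM.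
by rewrite /= fy fx.
Qed.

(** * Reduced words in graph products *)

Section NormalForm.
Variables (Gamma : sgraph) (G : Gamma -> groupType).
Local Notation word := (seq (letter G)).
Implicit Types (u v w : Gamma) (s t : word).

(** The letter at [v] that can be moved to the front of [s] past adjacent vertices, with default
    value 1 if there is none. The equality [e] transports it to [G v]. *)
Fixpoint initial v s : G v :=
  if s is x :: s' then
    match tag x =P v with
    | ReflectT e => etagged e
    | ReflectF _ => if adj v (tag x) then initial v s' else 1
    end
  else 1.

Fixpoint residue v s : word :=
  if s is x :: s' then
    if tag x == v then s'
    else if adj v (tag x) then x :: residue v s' else s
  else [::].

(** No letter is trivial, and none can be brought next to a later letter at the same vertex. *)
Fixpoint reduced s : bool :=
  if s is x :: s' then
    [&& tagged x != 1, initial (tag x) s' == 1 & reduced s']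
  else true.

Lemma adj_neq u v : adj u v -> u != v.
Proof. by apply: contraTneq => ->; rewrite adj_irr. Qed.

Lemma initial_same v (a : G v) s : initial v (lett a :: s) = a.
Proof. by rewrite /=; case: eqP => // e; rewrite eq_axiomK. Qed.

Lemma initial_adj v x s :
  adj v (tag x) -> initial v (x :: s) = initial v s.
Proof.
move=> vx; rewrite /= vx; case: eqP => // e.
by have := adj_neq vx; rewrite e eqxx.
Qed.

Lemma initial_nadj v x s :
  tag x != v -> ~~ adj v (tag x) -> initial v (x :: s) = 1.
Proof. by rewrite /=; case: eqP => // _ _ /negPf ->. Qed.

Lemma residue_same v (a : G v) s : residue v (lett a :: s) = s.
Proof. by rewrite /= eqxx. Qed.

Lemma residue_adj v x s :
  adj v (tag x) -> residue v (x :: s) = x :: residue v s.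
Proof. by move=> vx; rewrite /= vx eq_sym (negPf (adj_neq vx)). Qed.

Lemma residue_nadj v x s :
  tag x != v -> ~~ adj v (tag x) -> residue v (x :: s) = x :: s.
Proof. by rewrite /= => /negPf -> /negPf ->. Qed.

Variant letter_spec v : letter G -> Type :=
| LetterSame (a : G v) : letter_spec v (lett a)
| LetterAdj x of adj v (tag x) : letter_spec v x
| LetterNadj x of tag x != v & ~~ adj v (tag x) : letter_spec v x.

Lemma letterP v x : letter_spec v x.
Proof.
case: x => w a; have [e|nwv] := eqVneq w v.
  by subst w; exact: LetterSame.
by case: (boolP (adj v w)) => vw; [exact: LetterAdj|exact: LetterNadj].
Qed.

(** * The left action of the vertex groups on reduced words *)

Definition prepend v (a : G v) s : word := if a == 1 then s else lett a :: s.

(** Left multiplication by [a], which absorbs the initial letter at [v]. As in van der Waerden's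
    argument for free products, the relations are checked on this action, with no confluence proof
    for a rewriting system. *)
Definition act v (a : G v) s : word :=
  prepend (a * initial v s) (residue v s).

Definition act_word s t : word :=
  foldr (fun x => act (tagged x)) t s.

Definition nform s : word := act_word s [::].

Lemma act_word_cat s1 s2 t :
  act_word (s1 ++ s2) t = act_word s1 (act_word s2 t).
Proof. exact: foldr_cat. Qed.

Lemma initial_residue_adj u v s :
  adj u v -> initial u (residue v s) = initial u s.
Proof.
move=> uv; have vu : adj v u by rewrite adj_sym.
elim: s => // x s IHs; case: (letterP v x) => [a|{}x vx|{}x xv nvx].
- by rewrite residue_same initial_adj.
- rewrite residue_adj //; case: (letterP u x) vx => [a|{}x ux|{}x xu nux] vx.
  + by rewrite !initial_same.
  + by rewrite !initial_adj.
  + by rewrite !initial_nadj.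
- by rewrite residue_nadj.
Qed.

Lemma residueC u v s :
  adj u v -> residue u (residue v s) = residue v (residue u s).
Proof.
move=> uv; have vu : adj v u by rewrite adj_sym.
elim: s => // x s IHs; case: (letterP v x) => [a|{}x vx|{}x xv nvx].
- by rewrite residue_same residue_adj // residue_same.
- rewrite residue_adj //; case: (letterP u x) vx => [a|{}x ux|{}x xu nux] vx.
  + by rewrite !residue_same.
  + by rewrite !residue_adj // IHs.
  + by rewrite !(residue_nadj _ xu nux) residue_adj.
- rewrite residue_nadj //.
  case: (letterP u x) xv nvx => [a|{}x ux|{}x xu nux] xv nvx.
  + by rewrite vu in nvx.
  + by rewrite (residue_adj _ ux) residue_nadj.
  + by rewrite (residue_nadj _ xu nux) residue_nadj.
Qed.

Lemma initial_residue v s : reduced s -> initial v (residue v s) = 1.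
Proof.
elim: s => // x s IHs /= /and3P[_ xs rs].
case: (letterP v x) xs => [a|{}x vx|{}x xv nvx] xs.
- by rewrite eqxx; exact/eqP.
- by rewrite -/(residue v (x :: s)) residue_adj // initial_adj // IHs.
- by rewrite -/(residue v (x :: s)) residue_nadj // initial_nadj.
Qed.

Lemma reduced_residue v s : reduced s -> reduced (residue v s).
Proof.
elim: s => // x s IHs /= /and3P[x1 xs rs].
case: (letterP v x) x1 xs => [a|{}x vx|{}x xv nvx] x1 xs.
- by rewrite eqxx.
- rewrite -/(residue v (x :: s)) residue_adj //= x1 IHs //.
  by rewrite initial_residue_adj ?xs // adj_sym.
- by rewrite -/(residue v (x :: s)) residue_nadj //= x1 xs.
Qed.

Lemma residue_id v s : reduced s -> initial v s = 1 -> residue v s = s.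
Proof.
elim: s => // x s IHs /and3P[x1 _ rs].
case: (letterP v x) x1 => [a|{}x vx|{}x xv nvx] x1.
- by rewrite initial_same => a1; rewrite /= a1 eqxx in x1.
- by rewrite initial_adj // residue_adj // => /IHs->.
- by rewrite residue_nadj.
Qed.

Lemma initial_prepend v (a : G v) s :
  initial v s = 1 -> initial v (prepend a s) = a.
Proof. by rewrite /prepend; case: eqP => [->|_ _] //; exact: initial_same. Qed.

Lemma initial_prepend_adj u v (a : G v) s :
  adj u v -> initial u (prepend a s) = initial u s.
Proof. by rewrite /prepend; case: eqP => // _ uv; exact: initial_adj. Qed.

Lemma residue_prepend v (a : G v) s :
  reduced s -> initial v s = 1 -> residue v (prepend a s) = s.
Proof.
by rewrite /prepend; case: eqP => _ rs s1; [exact: residue_id|exact: residue_same].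
Qed.

Lemma residue_prepend_adj u v (a : G v) s :
  adj u v -> residue u (prepend a s) = prepend a (residue u s).
Proof. by rewrite /prepend; case: eqP => // _ uv; exact: residue_adj. Qed.

Lemma reduced_prepend v (a : G v) s :
  reduced s -> initial v s = 1 -> reduced (prepend a s).
Proof. by rewrite /prepend; case: eqP => //= /eqP-> -> ->; rewrite eqxx. Qed.

Lemma reduced_act v (a : G v) s : reduced s -> reduced (act a s).
Proof.
by move=> rs; apply: reduced_prepend; [exact: reduced_residue|exact: initial_residue].
Qed.

Lemma reduced_act_word s t : reduced t -> reduced (act_word s t).
Proof. by move=> rt; elim: s => //= x s; exact: reduced_act. Qed.

Lemma nform_reduced s : reduced (nform s).
Proof. exact: reduced_act_word. Qed.

Lemma reduced_nform s : reduced s -> nform s = s.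
Proof.
elim: s => // -[v a] s IHs /= /and3P[/= a1 /eqP s1 rs].
rewrite /nform /= -/(nform s) IHs // /act s1 mulg1 residue_id // /prepend.
by rewrite (negPf a1).
Qed.

(* A word up to commutation of letters is determined by its projections on
   the pairs of non-adjacent (possibly equal) vertices. *)
Definition proj u v s : word := [seq x <- s | (tag x == u) || (tag x == v)].

Definition shuffle s t : Prop :=
  forall u v, ~~ adj u v -> proj u v s = proj u v t.

Lemma shuffle_sym s t : shuffle s t -> shuffle t s.
Proof. by move=> st u v uv; rewrite st. Qed.

Lemma shuffle_trans s t r : shuffle s t -> shuffle t r -> shuffle s r.
Proof. by move=> st tr u v uv; rewrite st // tr. Qed.

Lemma shuffle_cons x s t : shuffle s t -> shuffle (x :: s) (x :: t).
Proof. by move=> st u v uv; rewrite /proj /= -!/(proj u v _) st. Qed.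

Lemma shuffle_cons_inj x s t : shuffle (x :: s) (x :: t) -> shuffle s t.
Proof.
move=> st u v uv; have := st u v uv; rewrite /proj /=.
by case: ifP => // _ [].
Qed.

Lemma shuffle_swap x y s :
  adj (tag x) (tag y) -> shuffle (x :: y :: s) (y :: x :: s).
Proof.
move=> xy u v uv; rewrite /proj /=.
case: ifP => // /orP Hx; case: ifP => // /orP Hy.
have yx := xy; rewrite adj_sym in yx.
case: Hx Hy => /eqP Hx [] /eqP Hy; rewrite Hx Hy ?adj_irr ?(negPf uv) // in xy yx.
Qed.

Lemma shuffle_prepend v (a : G v) s t :
  shuffle s t -> shuffle (prepend a s) (prepend a t).
Proof. by rewrite /prepend; case: ifP => // _; exact: shuffle_cons. Qed.

Lemma shuffle_prependC u v (a : G u) (b : G v) s :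
  adj u v -> shuffle (prepend a (prepend b s)) (prepend b (prepend a s)).
Proof.
move=> uv; rewrite /prepend; case: eqP => // _; case: eqP => // _.
exact: shuffle_swap.
Qed.

(** A letter at [v] can come to the front exactly when nothing at a vertex non-adjacent to [v]
    precedes it, and projections detect this. The case u = v singles out the first letter at [v].
    Hence [initial] is invariant under shuffles. *)
Lemma initial_proj v (a : G v) s : a != 1 ->
  initial v s = a <->
  forall u, ~~ adj v u -> ohead (proj v u s) = Some (lett a).
Proof.
move=> a1; elim: s => [|x s IHs].
  split=> [/= e|/(_ v)]; first by rewrite e eqxx in a1.
  by rewrite adj_irr => /(_ isT).
case: (letterP v x) => [b|{}x vx|{}x xv nvx].
- rewrite initial_same; split=> [-> u _|/(_ v)]; first by rewrite /proj /= eqxx.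
  rewrite adj_irr => /(_ isT); rewrite /proj /= eqxx /= => -[].
  by move/(congr1 (fun x => initial v [:: x])); rewrite !initial_same.
- rewrite initial_adj // IHs; split=> H u vu; have := H u vu; rewrite /proj /=.
    rewrite eq_sym (negPf (adj_neq vx)) /=; case: eqP => // e.
    by rewrite -e vx in vu.
  rewrite eq_sym (negPf (adj_neq vx)) /=; case: eqP => // e.
  by rewrite -e vx in vu.
- rewrite initial_nadj //; split=> [e|/(_ _ nvx)]; first by rewrite -e eqxx in a1.
  rewrite /proj /= eqxx orbT /= => -[] e.
  by rewrite e eqxx in xv.
Qed.

Lemma shuffle_initial v s t : shuffle s t -> initial v s = initial v t.
Proof.
move=> st; have [s1|s1] := eqVneq (initial v s) 1; last first.
  apply/esym/(initial_proj t s1) => u vu; rewrite -st //.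
  by move: u vu; apply/(initial_proj s s1).
have [->//|t1] := eqVneq (initial v t) 1.
apply/(initial_proj s t1) => u vu; rewrite st //.
by move: u vu; apply/(initial_proj t t1).
Qed.

(** The initial letter crosses only adjacent vertices on its way to the front. In a reduced word it
    is nontrivial, so [prepend] does not drop it. *)
Lemma shuffle_residue_prepend v s :
  reduced s -> shuffle s (prepend (initial v s) (residue v s)).
Proof.
elim: s => [_|x s IHs /and3P[x1 _ rs]]; first by rewrite /prepend eqxx.
case: (letterP v x) x1 => [a|{}x vx|{}x xv nvx] x1.
- by rewrite initial_same residue_same /prepend (negPf x1).
- rewrite initial_adj // residue_adj //.
  apply: (shuffle_trans (shuffle_cons x (IHs rs))).
  rewrite /prepend; case: ifP => // _; apply: shuffle_swap.
  by rewrite adj_sym.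
- by rewrite initial_nadj // residue_nadj // /prepend eqxx.
Qed.

(** After a shuffle both words begin with the same initial letter, which can be cancelled. *)
Lemma shuffle_residue v s t : reduced s -> reduced t ->
  shuffle s t -> shuffle (residue v s) (residue v t).
Proof.
move=> rs rt st; have e := shuffle_initial v st.
have := shuffle_trans (shuffle_sym (shuffle_residue_prepend v rs))
  (shuffle_trans st (shuffle_residue_prepend v rt)).
by rewrite -e /prepend; case: ifP => // _; exact: shuffle_cons_inj.
Qed.

Lemma shuffle_act v (a : G v) s t : reduced s -> reduced t ->
  shuffle s t -> shuffle (act a s) (act a t).
Proof.
move=> rs rt st; rewrite /act (shuffle_initial v st).
exact/shuffle_prepend/shuffle_residue.
Qed.

Lemma shuffle_act_word r s t : reduced s -> reduced t ->
  shuffle s t -> shuffle (act_word r s) (act_word r t).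
Proof.
move=> rs rt st; elim: r => //= x r IHr.
by apply: shuffle_act; rewrite ?reduced_act_word.
Qed.

Lemma act1 v s : reduced s -> shuffle (act (1 : G v) s) s.
Proof.
by move=> rs; rewrite /act mul1g; apply: shuffle_sym; exact: shuffle_residue_prepend.
Qed.

Lemma actM v (a b : G v) s : reduced s -> act a (act b s) = act (a * b) s.
Proof.
move=> rs; rewrite /act initial_prepend ?initial_residue // mulgA.
by rewrite residue_prepend ?initial_residue ?reduced_residue.
Qed.

Lemma actC u v (a : G u) (b : G v) s :
  adj u v -> shuffle (act a (act b s)) (act b (act a s)).
Proof.
move=> uv; have vu : adj v u by rewrite adj_sym.
rewrite /act !initial_prepend_adj // !initial_residue_adj //.
rewrite !residue_prepend_adj // residueC //; exact: shuffle_prependC.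
Qed.

(** The two sides of each defining relation act alike on reduced words up to shuffle, and acting by
    a further prefix preserves shuffles. This is the uniqueness of reduced words up to
    commutation. *)
Lemma nform_equiv s t : gp_equiv s t -> shuffle (nform s) (nform t).
Proof.
elim=> {s t} [s t l r lr|//|s t _ /shuffle_sym//|s t r _ st _].
  2: exact: shuffle_trans.
have rt := nform_reduced t.
rewrite /nform !act_word_cat -/(nform t); apply: shuffle_act_word.
1,2: by do ?apply: reduced_act_word.
case: lr => [v|v a b|v w a b vw] /=.
- exact: act1.
- by rewrite actM.
- exact: actC.
Qed.

Lemma gp_class_residue v s :
  gp_class s = gp_inj (initial v s) * gp_class (residue v s).
Proof.
elim: s => [|x s IHs]; first by rewrite /= gp_inj1 mul1g.
case: (letterP v x) => [a|{}x vx|{}x xv nvx].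
- by rewrite initial_same residue_same gp_class_cons.
- rewrite initial_adj // residue_adj //; case: x vx => w a vw.
  rewrite !gp_class_cons IHs !mulgA; congr (_ * _).
  by apply/esym/gp_inj_comm.
- by rewrite initial_nadj // residue_nadj // gp_inj1 mul1g.
Qed.

Lemma gp_class_prepend v (a : G v) s :
  gp_class (prepend a s) = gp_inj a * gp_class s.
Proof.
by rewrite /prepend; case: eqP => [->|_]; rewrite ?gp_inj1 ?mul1g ?gp_class_cons.
Qed.

Lemma gp_class_nform s : gp_class (nform s) = gp_class s.
Proof.
elim: s => // -[v a] s IHs; rewrite gp_class_cons -IHs [in RHS](gp_class_residue v).
by rewrite /nform /= gp_class_prepend gp_injM mulgA.
Qed.

Lemma initial_nform_eq v s t :
  gp_class s = gp_class t -> initial v (nform s) = initial v (nform t).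
Proof. by move=> /gp_classP st; apply/shuffle_initial/nform_equiv. Qed.

Lemma initial_act_adj u v (a : G v) s :
  adj u v -> initial u (act a s) = initial u s.
Proof. by move=> uv; rewrite initial_prepend_adj // initial_residue_adj. Qed.

(** Of two letters at distinct non-adjacent vertices, the earlier one blocks the later one. *)
Lemma initial_exclusive u v s :
  u != v -> ~~ adj u v -> initial u s != 1 -> initial v s = 1.
Proof.
move=> uv nuv; elim: s => [|x s IHs]; first by rewrite /= eqxx.
case: (letterP u x) => [a _|{}x ux|{}x xu nux].
- by rewrite initial_nadj // adj_sym.
- rewrite initial_adj // => /IHs s1.
  case: (letterP v x) ux => [a|{}x vx|{}x xv nvx] ux.
  + by rewrite ux in nuv.
  + by rewrite initial_adj.
  + by rewrite initial_nadj.
- by rewrite initial_nadj // eqxx.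
Qed.

Lemma initial_act_nadj u v (a : G v) s : u != v -> ~~ adj u v -> a != 1 ->
  initial u s != 1 -> reduced s -> initial v (act a s) = a.
Proof.
move=> uv nuv a1 us rs; have vs := initial_exclusive uv nuv us.
by rewrite initial_prepend ?initial_residue // vs mulg1.
Qed.

(** * Right multiplication of reduced words *)

Lemma initial_cat v s t : initial v s != 1 -> initial v (s ++ t) = initial v s.
Proof.
elim: s => [|x s IHs] /=; first by rewrite eqxx.
by case: eqP => // _; case: ifP => // _; rewrite eqxx.
Qed.

(** What a letter blocks depends only on its vertex, and [initial] compares with 1 only through the
    letter being trivial or not. *)
Lemma initial_subst_eq1 u v (c d : G v) s t : c != 1 -> d != 1 ->
  (initial u (s ++ lett c :: t) == 1) = (initial u (s ++ lett d :: t) == 1).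
Proof.
move=> c1 d1; elim: s => [|x s IHs] /=; last by case: eqP => // _; case: ifP.
by case: eqP => // e; case: _ / e; rewrite (negPf c1) (negPf d1).
Qed.

Lemma initial_absent u v s :
  ~~ adj u v -> all (fun x => adj v (tag x)) s -> initial u s = 1.
Proof.
move=> uv; elim: s => // x s IHs /= /andP[vx vs].
case: eqP => [e|_]; last by case: ifP => // _; exact: IHs.
by case/negP: uv; rewrite -e adj_sym.
Qed.

(** Deleting [c] could only unblock a vertex not adjacent to [v], but all letters of [t] lie in the
    link of [v]. *)
Lemma initial_delete_eq1 u v (c : G v) s t : c != 1 ->
    all (fun x => adj v (tag x)) t ->
  initial u (s ++ lett c :: t) = 1 -> initial u (s ++ t) = 1.
Proof.
move=> c1 vt; elim: s => [|x s IHs] /=.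
  case: eqP => [e|_]; first by case: _ / e => /= e; rewrite e eqxx in c1.
  by case: ifPn => // uv _; exact: initial_absent vt.
by case: eqP => // _; case: ifP.
Qed.

Lemma initial_delete_neq1 u v (c : G v) s t : u != v ->
  initial u (s ++ lett c :: t) != 1 -> initial u (s ++ t) != 1.
Proof.
move=> uv; elim: s => [|x s IHs] /=.
  by case: eqP => [e|_]; [rewrite e eqxx in uv|case: ifP => //; rewrite eqxx].
by case: eqP => // _; case: ifP.
Qed.

Lemma reduced_letter v (c : G v) s t : reduced (s ++ lett c :: t) -> c != 1.
Proof. by elim: s => [|x s IHs] /= /and3P[]. Qed.

Lemma reduced_subst v (c d : G v) s t : d != 1 ->
  reduced (s ++ lett c :: t) -> reduced (s ++ lett d :: t).
Proof.
move=> d1; elim: s => [|x s IHs] /=; first by rewrite d1 => /and3P[_ -> ->].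
move=> /and3P[-> xs rs]; rewrite IHs // andbT /=.
by rewrite (initial_subst_eq1 _ _ _ d1 (reduced_letter rs)).
Qed.

Lemma reduced_delete v (c : G v) s t : all (fun x => adj v (tag x)) t ->
  reduced (s ++ lett c :: t) -> reduced (s ++ t).
Proof.
move=> vt; elim: s => [|x s IHs] /=; first by case/and3P.
move=> /and3P[-> /eqP xs rs]; rewrite IHs // andbT /=; apply/eqP.
exact: initial_delete_eq1 (reduced_letter rs) vt xs.
Qed.

Lemma initial_rcons u v (b : G v) s : reduced s -> initial u s = 1 ->
    initial u (rcons s (lett b)) != 1 ->
  u = v /\ all (fun x => adj v (tag x)) s.
Proof.
elim: s => [_ _|x s IHs] /=.
  by case: eqP => [/esym|_] //; rewrite if_same eqxx.
case/and3P=> x1 _ rs.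
case: eqP => [e|_]; first by case: _ / e => /= e; rewrite e eqxx in x1.
case: ifP => [ux s1 /(IHs rs s1)[<- us]|]; last by rewrite eqxx.
by rewrite ux.
Qed.

(** Only an earlier letter at [v] that can be moved to the end of [s] can meet the appended
    letter. *)
Lemma reduced_rcons v (b : G v) s : b != 1 -> reduced s ->
  reduced (rcons s (lett b)) \/
  exists s1 (c : G v) s2,
    s = s1 ++ lett c :: s2 /\ all (fun x => adj v (tag x)) s2.
Proof.
move=> b1; elim: s => [_|x s IHs /= /and3P[x1 /eqP xs rs]].
  by left; rewrite /= b1 eqxx.
have [rsb|[s1 [c [s2 [-> vs2]]]]] := IHs rs; last first.
  by right; exists (x :: s1), c, s2.
have [e|e] := eqVneq (initial (tag x) (rcons s (lett b))) 1.
  by left; rewrite x1 rsb.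
have [e' vs] := initial_rcons rs xs e.
case: x e' {x1 xs e} => w c /= e; subst w.
by right; exists [::], c, s.
Qed.

Lemma gp_inj_class_comm v (b : G v) s : all (fun x => adj v (tag x)) s ->
  commute (gp_inj b) (gp_class s).
Proof.
elim: s => [_|[w c] s IHs /= /andP[vw vs]]; first exact: commute1.
by rewrite gp_class_cons; apply: commuteM; [exact: gp_inj_comm|exact: IHs].
Qed.

(** The letter [b] is appended, or it merges with or cancels a letter at [v]. None of these changes
    blocks an initial letter at another vertex. *)
Lemma mulr_letter v (b : G v) s : reduced s ->
  exists t, [/\ reduced t, gp_class t = gp_class s * gp_inj b &
    forall u, u != v -> initial u s != 1 -> initial u t != 1].
Proof.
move=> rs; have [->|b1] := eqVneq b 1.
  by exists s; rewrite gp_inj1 mulg1.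
case: (reduced_rcons b1 rs) => [rsb|[s1 [c [s2 [es vs2]]]]].
  exists (rcons s (lett b)); split=> //; first by rewrite -cats1 gp_classM.
  by move=> u _ us; rewrite -cats1 initial_cat.
have e (d : G v) :
    gp_class (s1 ++ lett d :: s2) = gp_class s1 * gp_class s2 * gp_inj d.
  by rewrite gp_classM gp_class_cons (gp_inj_class_comm d vs2) mulgA.
have [cb|cb] := eqVneq (c * b) 1.
  exists (s1 ++ s2); split; first by apply: (reduced_delete (c := c)); rewrite -?es.
    by rewrite es e -mulgA -gp_injM cb gp_inj1 mulg1 gp_classM.
  by move=> u uv; rewrite es; exact: initial_delete_neq1.
exists (s1 ++ lett (c * b) :: s2); split.
- by apply: (reduced_subst (c := c)); rewrite -?es.
- by rewrite es !e gp_injM mulgA.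
move=> u _; rewrite es (initial_subst_eq1 u s1 s2 _ cb) //.
by move: rs; rewrite es => /reduced_letter.
Qed.

Lemma mulr_word r s : reduced s ->
  exists t, [/\ reduced t, gp_class t = gp_class s * gp_class r &
    forall u, u \notin [seq tag x | x <- r] ->
      initial u s != 1 -> initial u t != 1].
Proof.
elim: r s => [|[v b] r IHr] s rs.
  by exists s; split=> //; rewrite -gp_classM cats0.
have [t [rt et ut]] := mulr_letter b rs; have [t' [rt' et' ut']] := IHr t rt.
exists t'; split=> //; first by rewrite et' et gp_class_cons mulgA.
by move=> u; rewrite inE negb_or => /andP[uv ur] us; apply: ut' => //; exact: ut.
Qed.

End NormalForm.

Lemma act_word_adj (Gamma : sgraph) (G : Gamma -> groupType) u
    (s t : seq (letter G)) :
  all (fun x => adj u (tag x)) s -> initial u (act_word s t) = initial u t.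
Proof.
by elim: s => // x s IHs /= /andP[ux us]; rewrite initial_act_adj // IHs.
Qed.

Lemma commute_gp_class (Gamma : sgraph) (G : Gamma -> groupType)
    (y : graph_product G) (s : seq (letter G)) :
    (forall x, x \in s -> commute y (gp_inj (tagged x))) ->
  commute y (gp_class s).
Proof.
elim: s => [_|[v a] s IHs ys]; first exact: commute1.
rewrite gp_class_cons; apply: commuteM.
  by apply: (ys (lett a)); rewrite inE eqxx.
by apply: IHs => x xs; apply: ys; rewrite inE xs orbT.
Qed.

(** * Functoriality of graph products in the vertex groups *)

Section GraphProductIso.
Variables (Gamma : sgraph) (G H : Gamma -> groupType).

Definition gp_map (f : forall v, G v -> H v) :
    graph_product G -> graph_product H :=
  gp_lift (fun v a => gp_inj (f v a)).

Variables (f : forall v, G v -> H v).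
Hypothesis fM : forall v, {morph @f v : a b / a * b}.

Let fM' (v : Gamma) : {morph (fun a : G v => gp_inj (f a)) : a b / a * b}.
Proof. by move=> a b; rewrite fM gp_injM. Qed.

Let fC' (v w : Gamma) (a : G v) (b : G w) :
  adj v w -> commute (gp_inj (f a)) (gp_inj (f b)).
Proof. exact: gp_inj_comm. Qed.

Lemma gp_mapM : {morph gp_map (@f) : x y / x * y}.
Proof. exact: gp_liftM. Qed.

Lemma gp_map_inj (v : Gamma) (a : G v) : gp_map (@f) (gp_inj a) = gp_inj (f a).
Proof. exact: (gp_lift_inj fM' fC'). Qed.

End GraphProductIso.

Lemma gp_mapK (Gamma : sgraph) (G H : Gamma -> groupType)
    (f : forall v, G v -> H v) (f' : forall v, H v -> G v) :
    (forall v, {morph f v : a b / a * b}) ->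
    (forall v, {morph f' v : a b / a * b}) ->
    (forall v, cancel (f v) (f' v)) ->
  cancel (gp_map f) (gp_map f').
Proof.
move=> fM f'M fK.
apply: (@gp_hom_ext _ _ _ (gp_map f' \o gp_map f) id) => // [x y|v a] /=.
  by rewrite (gp_mapM fM) (gp_mapM f'M).
by rewrite (gp_map_inj fM) (gp_map_inj f'M) fK.
Qed.

(** * Components and separating intersections of links *)

Section Components.
Variable Gamma : sgraph.
Implicit Types (v w x y : Gamma) (A B C D : {set Gamma}).

Lemma dist_ge2E v w : dist_ge2 v w = (w \notin st v).
Proof.
rewrite /dist_ge2 /dist !inE negb_or; case: pselect => [ex|nex]; last first.
  apply/esym/andP; split.
    apply: contra_notN nex => /eqP->; exists 0%N.
    by apply/asboolP; exists [::].
  apply: contra_notN nex => vw; exists 1%N.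
  by apply/asboolP; exists [:: w]; rewrite /= vw.
case: ex_minnP => n /asboolP[p [pp pw <-]] pmin.
case: p pp pw pmin => [|y [|z p]] /= pp pw pmin.
- by rewrite pw eqxx.
- by rewrite andbT pw in pp; rewrite pp andbF.
- apply/esym/andP; split; apply/negP => wv.
    suff /pmin : is_walk_length v w 0 by [].
    by apply/asboolP; exists [::]; split=> //; rewrite (eqP wv).
  suff /pmin : is_walk_length v w 1 by [].
  by apply/asboolP; exists [:: w]; rewrite /= wv.
Qed.

Lemma mem_components A x : x \in A -> exists2 C, C \in components A & x \in C.
Proof.
move=> xA; exists [set y in A | connect (induced_adj A) x y].
  exact: imset_f.
by rewrite inE xA connect0.
Qed.

Lemma components_connect A C x y : C \in components A -> x \in C -> y \in C ->
  connect (induced_adj A) x y.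
Proof.
move=> /imsetP[z zA ->]; rewrite !inE => /andP[_ zx] /andP[_ zy].
apply: connect_trans zy; rewrite sym_connect_sym // => a b.
by rewrite /induced_adj /= adj_sym andbCA.
Qed.

Lemma components_nonempty A C : C \in components A -> exists x, x \in C.
Proof.
by move=> /imsetP[z zA ->]; exists z; rewrite inE zA connect0.
Qed.

Lemma components_eq A C D x : C \in components A -> D \in components A ->
  x \in C -> x \in D -> C = D.
Proof.
move=> CA DA xC xD.
have /and3P[_ /finset.trivIsetP tI _] :=
  equivalence_partitionP (@induced_connect_equiv _ A).
apply/eqP/negPn/negP => /(tI _ _ CA DA) /pred0P /(_ x) /=.
by rewrite xC xD.
Qed.

Lemma connect_closed A D x y : x \in D ->
    (forall a b, a \in D -> a \in A -> b \in A -> adj a b -> b \in D) ->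
  connect (induced_adj A) x y -> y \in D.
Proof.
move=> xD clD /connectP[p pp ->]; elim: p x xD pp => //= z p IHp x xD.
by move=> /andP[/and3P[xA zA xz]]; apply: IHp; exact: clD xz.
Qed.

Hypothesis no_SIL : ~ has_SIL Gamma.

(** The component of the complement of lk(v) ∩ lk(w) meeting D contains v or w, both outside D. So
    an edge leaves D inside that complement; it can only end in lk(w), hence outside lk(v). *)
Lemma no_SIL_exit v w D : w \notin st v -> D \in components (~: st w) ->
    v \notin D ->
  exists y u, [/\ y \in D, adj y u, adj u w & u \notin st v].
Proof.
move=> wv Dw vD; have [x xD] := components_nonempty Dw.
have Dst z : z \in D -> z \notin st w.
  by move=> zD; have /fintype.subsetP/(_ z zD) := components_sub Dw; rewrite inE.
have xL : x \in ~: (lk v :&: lk w).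
  by have := Dst x xD; rewrite !inE !negb_or => /andP[_ /negPf->]; rewrite andbF.
have [C CL xC] := mem_components xL.
have [z zC zD] : exists2 z, z \in C & z \notin D.
  have [vC|vC] := boolP (v \in C); first by exists v.
  have [wC|wC] := boolP (w \in C).
    by exists w => //; apply/negP => /Dst; rewrite !inE eqxx.
  by case: no_SIL; exists v, w; split; [rewrite dist_ge2E|exists C].
have [[y [u [yD uD uL yu]]]|nyu] := pselect (exists y u,
    [/\ y \in D, u \notin D, u \in ~: (lk v :&: lk w) & adj y u]); last first.
  case/negP: zD; apply: connect_closed (components_connect CL xC zC) => //.
  move=> a b aD _ bL ab; apply: contrapT => /negP bD.
  by apply: nyu; exists a, b.
have ust : u \in st w.
  by apply: contraNT uD => ust; apply: (components_adj Dw yD _ yu); rewrite inE.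
have yw := Dst y yD; rewrite !inE in yw ust uL wv; rewrite !negb_or in yw wv.
exists y, u; rewrite yD yu !inE negb_or.
case/andP: yw => _ wy; case/andP: wv => _ nvw.
have uw : adj u w.
  case/orP: ust => [/eqP e|]; last by rewrite adj_sym.
  by rewrite -e adj_sym yu in wy.
split=> //; apply/andP; split.
  by apply/negP => /eqP e; rewrite -e uw in nvw.
by rewrite (adj_sym w) uw andbT in uL.
Qed.

(** D is connected and avoids st(v), so it lies in one component of its complement. The path y, u, w
    given by [no_SIL_exit] avoids st(v) too, so this component is the one containing w. *)
Lemma no_SIL_component v w C D :
    w \notin st v -> C \in components (~: st v) -> D \in components (~: st w) ->
    v \notin D ->
  if w \in C then D \subset C else [disjoint D & C].
Proof.
move=> wv Cv Dw vD; have [y [u [yD yu uw uv]]] := no_SIL_exit wv Dw vD.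
have vw : v \notin st w by move: wv; rewrite !inE eq_sym adj_sym.
(* A neighbour of v in D would bring v, which is outside st(w), into D. *)
have Dst z : z \in D -> z \in ~: st v.
  move=> zD; rewrite !inE negb_or; apply/andP; split.
    by apply: contraNneq vD => <-.
  apply: contraNN vD => vz; apply: (components_adj Dw zD); first by rewrite inE.
  by rewrite adj_sym.
have trans a b : a \in D -> b \in D -> a \in C -> b \in C.
  move=> aD bD aC; suff: b \in C :&: D by rewrite inE => /andP[].
  apply: connect_closed (components_connect Dw aD bD); first by rewrite inE aC.
  move=> a1 b1; rewrite inE => /andP[a1C a1D] _ b1w ab.
  have b1D : b1 \in D by exact: components_adj Dw a1D b1w ab.
  by rewrite inE b1D andbT; apply: (components_adj Cv a1C _ ab); exact: Dst.
have uw' : adj w u by rewrite adj_sym.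
have yu' : adj u y by rewrite adj_sym.
case: ifPn => wC.
  have uC : u \in C by apply: (components_adj Cv wC _ uw'); rewrite inE.
  have yC : y \in C by exact: (components_adj Cv uC (Dst y yD) yu').
  by apply/fintype.subsetP => z zD; exact: trans yD zD yC.
apply/pred0P => z /=; apply/negP => /andP[zD zC]; case/negP: wC.
have yC : y \in C by exact: trans zD yD zC.
have uC : u \in C by apply: (components_adj Cv yC _ yu); rewrite inE.
by apply: (components_adj Cv uC _ uw); rewrite inE.
Qed.

End Components.

(** * The kernel of the map to automorphisms *)

Section PcIndex.
Variable Gamma : sgraph.
Implicit Types (v w : Gamma) (p q : pc_index Gamma).

Lemma pc_adjE p q : pc_adj p q =
  (p != q) && ~~ ((pc_vertex p \in pc_comp q) && (pc_vertex q \in pc_comp p)).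
Proof.
rewrite /pc_adj dist_ge2E; congr (_ && ~~ _).
by case: (boolP (_ \in pc_comp p)) => [/pc_comp_st->|_] //; rewrite !andbF.
Qed.

Definition star_comp v : Type :=
  {C : {set Gamma} | C \in components (~: st v)}.
HB.instance Definition _ v := SubFinite.on (star_comp v).

(* Built with [proj1_sig] and [proj2_sig] so that [pc_vertex (star_pc C)]
   reduces to [v], and every index is convertible to one of this form. *)
Definition star_pc v (C : star_comp v) : pc_index Gamma :=
  exist (fun p : Gamma * {set Gamma} => p.2 \in components (~: st p.1))
    (v, proj1_sig C) (proj2_sig C).

Lemma star_pc_inj v : injective (@star_pc v).
Proof. by move=> C D e; apply: val_inj; case: (congr1 val e). Qed.

Lemma star_pc_neq v w (C : star_comp v) (D : star_comp w) :
  v != w -> star_pc C != star_pc D.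
Proof. exact/contra_neq/(congr1 (@pc_vertex Gamma)). Qed.

Lemma star_comp_nmem v (C : star_comp v) x :
  x \in st v -> x \notin (proj1_sig C).
Proof.
by move=> xv; apply: contraL xv => xC; exact: (@pc_comp_st _ (star_pc C)).
Qed.

Lemma star_pc_adj v (C D : star_comp v) :
  C != D -> pc_adj (star_pc C) (star_pc D).
Proof.
move=> CD; rewrite pc_adjE (inj_eq (@star_pc_inj v)) CD /=.
by rewrite negb_and star_comp_nmem // !inE eqxx.
Qed.

Lemma star_pc_adj_nmem p v (D : star_comp v) :
  v \notin pc_comp p -> p != star_pc D -> pc_adj p (star_pc D).
Proof. by move=> vp pD; rewrite pc_adjE pD negb_and vp orbT. Qed.

End PcIndex.

(** * The equivariant map from the graph product to the one over the pc graph *)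

Section Kernel.
Variables (Gamma : sgraph) (G : Gamma -> groupType).
Hypothesis Gab : forall v (a b : G v), commute a b.

(** The model labelling, where letters at p_{v,C} are literally elements of G_v. Other cyclic labels
    are transported to it at the end. *)
Definition pc_group (p : pc_graph Gamma) : groupType := G (pc_vertex p).

Definition fan_letter v (b : G v) (C : star_comp v) : letter pc_group :=
  @lett (pc_graph Gamma) pc_group (star_pc C) b.

(** Kept as a word so that its individual letters can be inspected; the copies commute, so the order
    of enumeration is immaterial in the group. *)
Definition fan v (b : G v) : seq (letter pc_group) :=
  [seq fan_letter b C | C <- enum {: star_comp v}].

Lemma fan_letter_adj v (b : G v) (C : star_comp v) (l : seq (star_comp v)) :
  C \notin l ->
  all (fun x => @adj (pc_graph Gamma) (star_pc C) (tag x))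
    [seq fan_letter b D | D <- l].
Proof.
move=> Cl; apply/allP => _ /mapP[D Dl ->] /=; apply: star_pc_adj.
by apply: contraNneq Cl => ->.
Qed.

Lemma fanM v : {morph (fun b : G v => gp_class (fan b)) : a b / a * b}.
Proof.
move=> a b; rewrite /fan; elim: (enum _) (enum_uniq {: star_comp v}) => [|C l IHl].
  by rewrite /= mulg1.
move=> /andP[Cl /IHl e]; rewrite /= !gp_class_cons e gp_injM.
rewrite -!mulgA; congr (_ * _); rewrite !mulgA; congr (_ * _).
exact/gp_inj_class_comm/fan_letter_adj.
Qed.

(** Since w is in st(v), it lies in no component C, so every p_{v,C} is adjacent to every
    p_{w,D}. *)
Lemma fanC v w (a : G v) (b : G w) :
  adj v w -> commute (gp_class (fan a)) (gp_class (fan b)).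
Proof.
move=> vw; have wv : adj w v by rewrite adj_sym.
rewrite /fan; elim: (enum {: star_comp v}) => [|C l IHl].
  exact/commute_sym/commute1.
rewrite /= gp_class_cons; apply: commute_sym.
apply: commuteM; apply: commute_sym => //.
apply: gp_inj_class_comm; apply/allP => _ /mapP[D _ ->] /=.
apply: star_pc_adj_nmem; first by apply: star_comp_nmem; rewrite !inE vw orbT.
by apply: star_pc_neq; exact: adj_neq.
Qed.

Definition iota_pc : graph_product G -> graph_product pc_group :=
  gp_lift (fun v (b : G v) => gp_class (fan b)).

Lemma iota_pcM : {morph iota_pc : x y / x * y}.
Proof. apply: gp_liftM; [exact: fanM|exact: fanC]. Qed.

Lemma iota_pc_inj v (b : G v) : iota_pc (gp_inj b) = gp_class (fan b).
Proof. by apply: gp_lift_inj; [exact: fanM|exact: fanC]. Qed.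

Lemma fan_split v (b : G v) (C : star_comp v) : exists l1 l2,
  [/\ C \notin l1, C \notin l2 &
  fan b = [seq fan_letter b D | D <- l1] ++
          fan_letter b C :: [seq fan_letter b D | D <- l2]].
Proof.
have : C \in enum {: star_comp v} by rewrite mem_enum.
rewrite /fan; move: (enum _) (enum_uniq {: star_comp v}) => l ul Cl.
case/splitPr: Cl ul => l1 l2; rewrite cat_uniq /= => /and3P[_ + /andP[Cl2 _]].
rewrite negb_or => /andP[Cl1 _]; exists l1, l2; split=> //.
by rewrite map_cat.
Qed.

(** For a generator at x outside the component C of p, [a] commutes with the whole fan. For x in C,
    the fan of [a] is its letter at p times letters at other components; x is in none of these, so
    they commute with the fan of [b] and cancel. *)
Lemma iota_pconj p (a : pc_group p) (z : graph_product G) :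
  iota_pc (pconj_fun a z) = gp_inj a * iota_pc z * (gp_inj a)^-1.
Proof.
apply: (@gp_hom_ext _ _ _ (iota_pc \o pconj_fun a)
  (fun z => gp_inj a * iota_pc z * (gp_inj a)^-1)) => [y1 y2|y1 y2|x b] /=.
- by rewrite pconj_funM iota_pcM.
- by rewrite iota_pcM !mulgA mulgVK.
rewrite pconj_fun_inj /pconj_gens; case: ifPn => xp; last first.
  rewrite iota_pc_inj.
  suff -> : gp_inj a * gp_class (fan b) = gp_class (fan b) * gp_inj a.
    by rewrite mulgK.
  apply: commute_gp_class => _ /mapP[D _ ->] /=.
  case: p a xp => -[v C] vC a xp.
  (* Either the two indices are adjacent, or they coincide and commutativity of the vertex group
     applies. *)
  have [e|pD] := eqVneq (exist _ (v, C) vC : pc_index Gamma) (star_pc D); last first.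
    by apply: (@gp_inj_comm (pc_graph Gamma)); exact: star_pc_adj_nmem.
  have evx : v = x by case: e.
  subst x; have <- : (exist _ C vC : star_comp v) = D by exact: star_pc_inj.
  rewrite /commute.
  rewrite -[LHS](@gp_injM (pc_graph Gamma) pc_group).
  by rewrite -[RHS](@gp_injM (pc_graph Gamma) pc_group); congr gp_inj; exact: Gab.
rewrite !iota_pcM (morphVg iota_pcM) !iota_pc_inj.
case: p a xp => -[v C0] vC a xp.
pose C : star_comp v := exist _ C0 vC.
have [l1 [l2 [Cl1 Cl2 ->]]] := fan_split a C.
set r1 := [seq _ | D <- l1]; set r2 := [seq _ | D <- l2].
have eA : gp_class (r1 ++ fan_letter a C :: r2) =
    gp_inj (a : pc_group (star_pc C)) * gp_class (r1 ++ r2).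
  rewrite !gp_classM gp_class_cons !mulgA; congr (_ * _).
  exact/esym/gp_inj_class_comm/fan_letter_adj.
have cR : commute (gp_class (r1 ++ r2)) (gp_class (fan b)).
  apply/commute_sym/commute_gp_class => y.
  rewrite /r1 /r2 -map_cat => /mapP[D Dl ->].
  apply/commute_sym/gp_inj_class_comm/allP => _ /mapP[E _ ->] /=.
  have CD : C != D by apply: contraTneq Dl => <-; rewrite mem_cat negb_or Cl1.
  apply: star_pc_adj_nmem.
    apply/negP => xD; case/eqP: CD; apply: val_inj => /=.
    exact: (components_eq vC (proj2_sig D) xp xD).
  apply: star_pc_neq; apply: contraTneq xp => <-.
  by apply: (@star_comp_nmem _ v C); rewrite !inE eqxx.
rewrite eA invgM -!mulgA; congr (_ * _); rewrite !mulgA; congr (_ * _).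
by rewrite cR mulgK.
Qed.

Hypothesis Gnt : forall v, exists a : G v, a <> 1.

Lemma fan_centralizer (y : graph_product pc_group) :
  (forall v (b : G v), commute y (gp_class (fan b))) -> y = 1.
Proof.
move=> cy; rewrite -(gp_classK y) -gp_class_nform in cy *.
(* The empty normal form gives y = 1; otherwise the first letter fixes p. *)
case er : (nform (repr y)) (nform_reduced (repr y)) cy => [//|[p a] t] + cy.
set r := _ :: t in cy *; move=> rr.
have pr : initial p r != 1 by rewrite initial_same; case/and3P: rr.
have [v vp] := components_nonempty (valP p).
have vst := pc_comp_st vp; set w := pc_vertex p in vst.
have wv : w \in ~: st v by move: vst; rewrite !inE eq_sym adj_sym.
have nvw : w != v by move: vst; rewrite !inE negb_or eq_sym => /andP[].
(* Taking the component that contains w makes p and q non-adjacent, while p is adjacent to every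
   other index at v. *)
have [C0 C0v wC0] := mem_components wv.
pose C : star_comp v := exist _ C0 C0v; pose q : pc_graph Gamma := star_pc C.
have [b /eqP b1] := Gnt v.
have np D : p != star_pc (v := v) D.
  by apply: contra_neq nvw => /(congr1 (@pc_vertex Gamma)).
have npq : ~~ adj p q.
  by rewrite /= pc_adjE negb_and !negbK; apply/orP; right; apply/andP.
have padj (D : star_comp v) : C != D -> adj p (star_pc D : pc_graph Gamma).
  move=> CD; rewrite /= pc_adjE np /= negb_and.
  apply/orP; left; apply/negP => wD.
  by case/eqP: CD; apply: val_inj; exact: (components_eq C0v (proj2_sig D) wC0 wD).
have [l1 [l2 [Cl1 Cl2 eb]]] := fan_split b C.
(* Letters act from right to left: those of [l2] leave p initial, then b lands in front of it at q,
   and those of [l1] are adjacent to q. *)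
have qr : initial q (nform (fan b ++ r)) != 1.
  rewrite /nform act_word_cat -/(nform r) reduced_nform // eb act_word_cat /=.
  rewrite act_word_adj; last exact: fan_letter_adj.
  rewrite (initial_act_nadj (np C) npq) //; last exact: reduced_act_word.
  rewrite act_word_adj //; apply/allP => _ /mapP[D Dl ->]; apply: padj.
  by apply: contraTneq Dl => <-.
(* For the product in the other order, p stays initial because the fan has no letter there. *)
have [t' [rt' et' pt']] := mulr_word (fan b) rr.
have {}pt' : initial p t' != 1.
  apply: pt' => //; apply/mapP => -[_ /mapP[D _ ->]] /= e.
  by have := np D; rewrite e eqxx.
case/negP: qr; rewrite (initial_nform_eq q (t := t')); last first.
  by rewrite gp_classM et' cy.
by rewrite reduced_nform // (initial_exclusive (np C) npq pt').
Qed.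

End Kernel.

(** * Partial conjugations *)

Section PconjCommute.
Variables (Gamma : sgraph) (G : Gamma -> groupType).
Implicit Types p q : pc_index Gamma.

Lemma pconj_fun_in p (a : G (pc_vertex p)) x (b : G x) : x \in pc_comp p ->
  pconj_fun a (gp_inj b) = gp_inj a * gp_inj b * (gp_inj a)^-1.
Proof. by move=> xp; rewrite pconj_fun_inj /pconj_gens xp. Qed.

Lemma pconj_fun_out p (a : G (pc_vertex p)) x (b : G x) : x \notin pc_comp p ->
  pconj_fun a (gp_inj b) = gp_inj b.
Proof. by move=> xp; rewrite pconj_fun_inj /pconj_gens (negPf xp). Qed.

(** Conjugation by [b] fixes [a], so it is inserted inside the conjugation by [a]. The reversed
    order is harmless once the vertex group is commutative. *)
Lemma pconj_funMl p (a b : G (pc_vertex p)) z :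
  pconj_fun (a * b) z = pconj_fun b (pconj_fun a z).
Proof.
apply: (@gp_hom_ext _ _ _ (pconj_fun (a * b)) (pconj_fun b \o pconj_fun a)).
- exact: pconj_funM.
- by move=> x y /=; rewrite !pconj_funM.
move=> x c /=; have [xp|xp] := boolP (x \in pc_comp p).
  2: by rewrite !pconj_fun_out.
have pp : pc_vertex p \notin pc_comp p.
  by apply/negP => /pc_comp_st; rewrite !inE eqxx.
rewrite !pconj_fun_in // !pconj_funM (morphVg (pconj_funM b)) (pconj_fun_out _ _ pp).
by rewrite pconj_fun_in // gp_injM invgM !mulgA.
Qed.

(** On x in the smaller component both composites give a b x b^-1 a^-1: the map of [a] conjugates
    both [b] and x, and the map of [b] fixes [a]. *)
Lemma pconj_fun_nested p q (a : G (pc_vertex p)) (b : G (pc_vertex q)) :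
    pc_vertex p \notin pc_comp q -> pc_vertex q \in pc_comp p ->
    pc_comp q \subset pc_comp p ->
  pconj_fun a \o pconj_fun b =1 pconj_fun b \o pconj_fun a.
Proof.
move=> pq qp /fintype.subsetP qsp; apply: gp_hom_ext.
- by move=> x y /=; rewrite !pconj_funM.
- by move=> x y /=; rewrite !pconj_funM.
move=> x c /=; have [xq|xq] := boolP (x \in pc_comp q).
  rewrite (pconj_fun_in _ _ xq) (pconj_fun_in _ _ (qsp x xq)) !pconj_funM.
  rewrite (morphVg (pconj_funM a)) (morphVg (pconj_funM b)).
  rewrite (pconj_fun_out _ _ pq) !(pconj_fun_in _ _ qp) pconj_fun_in ?qsp //.
  by rewrite pconj_fun_in // !invgM !mulgA invgK !mulgVK.
rewrite (pconj_fun_out _ _ xq).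
have [xp|xp] := boolP (x \in pc_comp p); last by rewrite !pconj_fun_out.
rewrite pconj_fun_in // !pconj_funM (morphVg (pconj_funM b)).
by rewrite (pconj_fun_out _ _ pq) (pconj_fun_out _ _ xq).
Qed.

(** Each map fixes the conjugating element of the other. A generator moved by both occurs only for
    adjacent vertices, where [a] and [b] commute. *)
Lemma pconj_fun_disjoint p q (a : G (pc_vertex p)) (b : G (pc_vertex q)) :
    pc_vertex p \notin pc_comp q -> pc_vertex q \notin pc_comp p ->
    adj (pc_vertex p) (pc_vertex q) \/ [disjoint pc_comp p & pc_comp q] ->
  pconj_fun a \o pconj_fun b =1 pconj_fun b \o pconj_fun a.
Proof.
move=> pq qp dis; apply: gp_hom_ext.
- by move=> x y /=; rewrite !pconj_funM.
- by move=> x y /=; rewrite !pconj_funM.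
move=> x c /=; have [xq|xq] := boolP (x \in pc_comp q); last first.
  rewrite (pconj_fun_out _ _ xq).
  have [xp|xp] := boolP (x \in pc_comp p); last by rewrite !pconj_fun_out.
  rewrite pconj_fun_in // !pconj_funM (morphVg (pconj_funM b)).
  by rewrite (pconj_fun_out _ _ pq) (pconj_fun_out _ _ xq).
rewrite (pconj_fun_in _ _ xq) !pconj_funM (morphVg (pconj_funM a)).
rewrite (pconj_fun_out _ _ qp).
have [xp|xp] := boolP (x \in pc_comp p); last first.
  by rewrite (pconj_fun_out _ _ xp) pconj_fun_in.
rewrite !(pconj_fun_in _ _ xp) !pconj_funM (morphVg (pconj_funM b)).
rewrite (pconj_fun_out _ _ pq) (pconj_fun_in _ _ xq).
case: dis => [pqa|/pred0P/(_ x)]; last by rewrite /= xp xq.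
have ab := gp_inj_comm a b pqa.
have e : (gp_inj a)^-1 * (gp_inj b)^-1 = (gp_inj b)^-1 * (gp_inj a)^-1.
  by rewrite -!invgM ab.
by rewrite -!mulgA e !mulgA ab.
Qed.

Hypothesis no_SIL : ~ has_SIL Gamma.

(** Let p = p_{v,C} and q = p_{w,D}, with v outside D by symmetry. If w is outside st(v), the
    components are nested or disjoint. Otherwise v and w are adjacent, or equal, and then C and D
    are distinct components of one complement. *)
Lemma pconj_funC p q (a : G (pc_vertex p)) (b : G (pc_vertex q)) :
  pc_adj p q -> pconj_fun a \o pconj_fun b =1 pconj_fun b \o pconj_fun a.
Proof.
rewrite pc_adjE => /andP[npq]; rewrite negb_and.
wlog pq : p q a b npq / pc_vertex p \notin pc_comp q => [hw|_].
  case/orP=> pq; first by apply: hw; rewrite ?pq.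
  have qp : q != p by rewrite eq_sym.
  by move=> z; rewrite [RHS]hw // pq.
have [qst|qst] := boolP (pc_vertex q \in st (pc_vertex p)); last first.
  have := no_SIL_component no_SIL qst (valP p) (valP q) pq.
  rewrite -/(pc_comp p) -/(pc_comp q); case: ifPn => qp dis.
    exact: pconj_fun_nested.
  by apply: pconj_fun_disjoint => //; right; rewrite disjoint_sym.
have qp : pc_vertex q \notin pc_comp p by apply: contraL qst; exact: pc_comp_st.
apply: pconj_fun_disjoint => //.
move: qst; rewrite !inE => /orP[/eqP e|->]; last by left.
right; apply/pred0P => x /=; apply/negP => /andP[xp xq]; case/negP: npq.
apply/eqP/val_inj; move: e; rewrite /pc_vertex => e.
have := components_eq (valP p) _ xp xq; rewrite -e => /(_ (valP q)).
by rewrite /pc_comp; move: e; case: (val p) (val q) => [v C] [w D] /= -> ->.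
Qed.

End PconjCommute.

(** * The homomorphism onto the group generated by partial conjugations *)

Section PcAut.
Variables (Gamma : sgraph) (G : Gamma -> groupType) (g : forall v, G v).
Hypothesis g_gen : forall v, is_generator (g v).
Local Notation K := (pc_group G).

Lemma pconj_fun_is_aut p (a : K p) : is_aut (pconj_fun a).
Proof.
split; first exact: pconj_funM.
by exists (pconj_fun a^-1); apply: pconj_funK; [exact: mulVg|exact: mulgV].
Qed.

Definition pconj_aut p (a : K p) : Aut (graph_product G) :=
  mk_aut (pconj_fun_is_aut a).

Lemma pconj_autM p : {morph @pconj_aut p : a b / a * b}.
Proof.
move=> a b; apply/val_inj/funext => z /=.
by rewrite (generator_commute (@g_gen _) a b) pconj_funMl.
Qed.

Lemma pconj_aut_gen p : pconj_aut (g (pc_vertex p) : K p) = pconj g p.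
Proof. exact: val_inj. Qed.

(** [a] is a power of the generator or the inverse of one, and the corresponding power of
    [pi_pc g p] is already taken inside the subgroup. *)
Lemma pconj_aut_generated p (a : K p) :
  pconj_aut a \in generated_set (range (pconj g)).
Proof.
have valX n : val (pi_pc g p ^+ n) = pconj_aut (g (pc_vertex p) ^+ n : K p).
  rewrite (morphXg (@valM _ _ (Autpc g))) (morphXg (@pconj_autM p)).
  by rewrite pconj_aut_gen.
have [n [->|->]] := @g_gen (pc_vertex p) a; first by rewrite -valX; exact: valP.
rewrite (morphVg (@pconj_autM p)) -valX -(morphVg (@valM _ _ (Autpc g))).
exact: valP.
Qed.

Definition pc_aut p (a : K p) : Autpc g :=
  Sub (pconj_aut a) (pconj_aut_generated a).

Lemma pc_autM p : {morph @pc_aut p : a b / a * b}.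
Proof. by move=> a b; apply: val_inj; rewrite valM; exact: pconj_autM. Qed.

Lemma pc_aut_gen p : pc_aut (g (pc_vertex p) : K p) = pi_pc g p.
Proof. exact/val_inj/pconj_aut_gen. Qed.

Hypothesis no_SIL : ~ has_SIL Gamma.

Lemma pc_autC (p q : pc_graph Gamma) (a : K p) (b : K q) :
  adj p q -> commute (pc_aut a) (pc_aut b).
Proof.
move=> pq; apply/val_inj; rewrite !valM; apply/val_inj/funext => z.
exact: (pconj_funC no_SIL a b pq).
Qed.

Definition pc_map : graph_product K -> Autpc g := gp_lift pc_aut.

Lemma pc_mapM : {morph pc_map : x y / x * y}.
Proof. by apply: gp_liftM; [exact: pc_autM|exact: pc_autC]. Qed.

Lemma pc_map_inj p (a : K p) : pc_map (gp_inj a) = pc_aut a.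
Proof. by apply: gp_lift_inj; [exact: pc_autM|exact: pc_autC]. Qed.

(** Equivariance passes from letters to words, since composing automorphisms corresponds to nesting
    conjugations. *)
Lemma pc_map_iota (y : graph_product K) (z : graph_product G) :
  iota_pc (val (val (pc_map y)) z) = y * iota_pc z * y^-1.
Proof.
rewrite -(gp_classK y); elim: (repr y) z => [|[p a] s IHs] z.
  by rewrite (morph1g pc_mapM) val1 mul1g invg1 mulg1.
rewrite gp_class_cons pc_mapM pc_map_inj valM /=.
rewrite iota_pconj; last by move=> v b c; exact: generator_commute (@g_gen v) b c.
by rewrite IHs invgM !mulgA.
Qed.

Hypothesis G_nontrivial : forall v, exists a : G v, a <> 1.

Lemma pc_map_injective : injective pc_map.
Proof.
apply: (morph_injg pc_mapM) => y y1; apply: fan_centralizer => // v b.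
have := pc_map_iota y (gp_inj b); rewrite y1 val1 /= iota_pc_inj => e.
by rewrite /commute {2}e mulgVK.
Qed.

(** The image is a subgroup containing all partial conjugations, hence the smallest such
    subgroup. *)
Lemma pc_map_surjective (f : Autpc g) : exists y, pc_map y = f.
Proof.
suff: [set k | exists y, val (pc_map y) = k]%classic (val f).
  by move=> [y /val_inj <-]; exists y.
have /set_mem := valP f; apply; split.
  split=> [|k l]; first by apply/mem_set; exists 1; rewrite (morph1g pc_mapM) val1.
  move=> /set_mem[y <-] /set_mem[z <-]; apply/mem_set; exists (y / z).
  by rewrite pc_mapM (morphVg pc_mapM) valM (morphVg (@valM _ _ (Autpc g))).
move=> _ [p _ <-]; exists (@gp_inj (pc_graph Gamma) K p (g (pc_vertex p))).
by rewrite pc_map_inj pc_aut_gen.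
Qed.

Lemma pc_map_bijective : bijective pc_map.
Proof.
exists (fun f => sval (cid (pc_map_surjective f))) => y; case: cid => //= z.
exact: pc_map_injective.
Qed.

End PcAut.

(** * The isomorphism for arbitrary cyclic labels of the prescribed orders *)

Theorem theorem3p6 (Gamma : sgraph)
    (G : Gamma -> groupType) (g : forall v : Gamma, G v)
    (g_gen : forall v : Gamma, is_generator (g v))
    (G_nontrivial : forall v : Gamma, exists x : G v, x <> 1)
    (no_SIL : ~ has_SIL Gamma)
    (H : pc_graph Gamma -> groupType) (h : forall p : pc_graph Gamma, H p)
    (h_gen : forall p : pc_graph Gamma, is_generator (h p))
    (H_order : forall p : pc_graph Gamma, same_order (H p) (G (pc_vertex p))) :
  (exists phi : {multiplicative graph_product H -> Autpc g},
     [/\ forall p : pc_graph Gamma, phi (gp_inj (h p)) = pi_pc g p,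
         forall psi : {multiplicative graph_product H -> Autpc g},
           (forall p : pc_graph Gamma, psi (gp_inj (h p)) = pi_pc g p) ->
           psi =1 phi
       & bijective phi]) /\
  (exists K : pc_graph Gamma -> groupType,
     [/\ forall p : pc_graph Gamma, is_cyclic (K p),
         forall p : pc_graph Gamma, same_order (K p) (G (pc_vertex p))
       & isomorphic (graph_product K) (Autpc g)]).
Proof.
(* Isomorphisms matching the chosen generators transport the labels [H p] to the model labelling
   [pc_group G]. *)
pose e p := sval (cid (same_order_iso (h_gen p) (g_gen (pc_vertex p)) (H_order p))).
have eP p : [/\ {morph (e p).1 : a b / a * b}, {morph (e p).2 : a b / a * b},
    (e p).1 (h p) = g (pc_vertex p), cancel (e p).1 (e p).2 &
    cancel (e p).2 (e p).1].
  exact: svalP (cid (same_order_iso _ _ _)).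
pose f1 (p : pc_graph Gamma) : H p -> pc_group G p := (e p).1.
pose f2 (p : pc_graph Gamma) : pc_group G p -> H p := (e p).2.
have f1M p : {morph f1 p : a b / a * b} by case: (eP p).
have f2M p : {morph f2 p : a b / a * b} by case: (eP p).
have f1h p : f1 p (h p) = g (pc_vertex p) by case: (eP p).
have f1K p : cancel (f1 p) (f2 p) by case: (eP p).
have f2K p : cancel (f2 p) (f1 p) by case: (eP p).
pose phi0 : graph_product H -> Autpc g := pc_map g_gen \o gp_map f1.
have phiM : {morph phi0 : x y / x * y}.
  by move=> x y; rewrite /phi0 /= (gp_mapM f1M) (pc_mapM g_gen no_SIL).
have phi_bij : bijective phi0.
  apply: bij_comp; first exact: pc_map_bijective.
  by exists (gp_map f2); apply: gp_mapK.
pose phi : {multiplicative graph_product H -> Autpc g} :=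
  HB.pack phi0 (isMultiplicative.Build _ _ phi0 phiM).
have phih p : phi (gp_inj (h p)) = pi_pc g p.
  rewrite /= /phi0 /= (gp_map_inj f1M) f1h (pc_map_inj g_gen no_SIL).
  exact: pc_aut_gen.
split.
  (* Agreement at the generators [h p] gives agreement on each cyclic vertex group, hence on the
     graph product. *)
  exists phi; split=> // psi psih.
  apply: gp_hom_ext => [||p]; [exact: gmulfM|exact: phiM|].
  apply: (generator_ext (h_gen p)) => [a b|a b|]; last by rewrite psih phih.
    by rewrite gp_injM gmulfM.
  by rewrite gp_injM; exact: phiM.
by exists H; split=> // [p|]; [exists (h p)|exists phi].
Qed.
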